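(* For every $\varepsilon>0$ and every $p=p(n)\geq\frac{\ln n+\ln\ln n+\omega(1)}{n}$ the following holds with high probability: the random graph $G=([n],E)\sim G(n,p)$, with degree sequence $\mathbf{d}=(d_1,\ldots,d_n)$, is $\widetilde{\mathbf{d}}\left(\frac{np}{100},\varepsilon\right)$-resilient with respect to Hamiltonicity. That is, for every subgraph $H\subseteq G$ with $d_H(v)\leq \widetilde{d}_v$ for all $v\in[n]$, the graph $G-H$ contains a Hamilton cycle.
   Context: $G(n,p)$ is the binomial random graph on vertex set $[n]=\{1,\ldots,n\}$ in which each of the $\binom{n}{2}$ pairs is an edge independently with probability $p$. ''With high probability'' (w.h.p.) means with probability tending to $1$ as $n\to\infty$. $\omega(1)$ denotes an arbitrary function of $n$ tending to infinity. For a graph $G$ on $[n]$ and $t>0$ let $\mathcal{D}_t(G)=\{v\in[n]: d_G(v)<t\}$. Given $t>0$ and $\varepsilon>0$, the sequence $\widetilde{\mathbf{d}}(t,\varepsilon)=(\widetilde d_1,\ldots,\widetilde d_n)$ is defined by $\widetilde d_v=d_v-2$ for $v\in\mathcal{D}_t(G)$ and $\widetilde d_v=d_v\left(\frac13-\varepsilon\right)$ for $v\notin\mathcal{D}_t(G)$, where $d_v=d_G(v)$. For a sequence $\mathbf{k}=(k_1,\ldots,k_n)$ and a monotone increasing graph property $\mathcal{P}$, a graph $G$ on $[n]$ is $\mathbf{k}$-resilient with respect to $\mathcal{P}$ if for every (spanning) subgraph $H\subseteq G$ with $d_H(i)\leq k_i$ for all $i$, the graph $G-H$ (same vertex set, edge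 set $E(G)\setminus E(H)$) has $\mathcal{P}$. *)

(* Defs.v *)
From HB Require Import structures.
From mathcomp Require Import all_boot all_order all_algebra.
From mathcomp Require Import all_classical all_reals all_analysis.

Set Implicit Arguments.
Unset Strict Implicit.
Unset Printing Implicit Defensive.

Import Order.TTheory GRing.Theory Num.Theory.
Import numFieldNormedType.Exports.

Local Open Scope ring_scope.

Section SimpleGraphs.
Variable n : nat.

Definition vpairs : {set {set 'I_n}} := [set e : {set 'I_n} | #|e| == 2%N].

Record sgraph := SGraph {
  edges : {set {set 'I_n}};
  _ : edges \subset vpairs
}.

HB.instance Definition _ := [isSub for edges].
HB.instance Definition _ := [Finite of sgraph by <:].

Definition adj (G : sgraph) : rel 'I_n := fun u v => [set u; v] \in edges G.

Definition deg (G : sgraph) (v : 'I_n) : nat := #|[set u | adj G v u]|.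

Definition subgraph (H G : sgraph) : bool := edges H \subset edges G.

Lemma del_proof (G H : sgraph) : edges G :\: edges H \subset vpairs.
Proof. by case: G => E sEV; apply: fintype.subset_trans (finset.subsetDl _ _) sEV. Qed.

Definition del (G H : sgraph) : sgraph := SGraph (del_proof G H).

(* The tuple has n entries, so a duplicate-free one visits every vertex; the
   bound on n excludes the degenerate "cycles" on fewer than 3 vertices. *)
Definition hamiltonian (G : sgraph) : bool :=
  (2 < n)%N && [exists c : n.-tuple 'I_n, ucycleb (adj G) c].

Variable R : realType.

(* The bounds k may be negative reals, in which case no H is admissible. *)
Definition resilient (k : 'I_n -> R) (P : pred sgraph) (G : sgraph) : bool :=
  [forall H : sgraph,
    (subgraph H G && [forall v, (deg H v)%:R <= k v]) ==> P (del G H)].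

Definition low_deg (t : R) (G : sgraph) : {set 'I_n} :=
  [set v | (deg G v)%:R < t].

Definition dtilde (t eps : R) (G : sgraph) (v : 'I_n) : R :=
  if v \in low_deg t G then (deg G v)%:R - 2
  else (deg G v)%:R * (3^-1 - eps).

Definition gnp_mass (p : R) (G : sgraph) : R :=
  \prod_(e in vpairs) (if e \in edges G then p else 1 - p).

Definition gnp_prob (p : R) (A : pred sgraph) : R :=
  \sum_(G : sgraph | A G) gnp_mass p G.

End SimpleGraphs.

(* Main.v *)
(* Write x = np, so that eventually x >= ln n, and G' = G - H.  Call a vertex low if its degree in G
   is below x/100.  With high probability low vertices are few and scattered, small vertex sets span
   few edges, and the edge counts between large sets are concentrated.

   In G' choose a sparse spanning subgraph B (a small constant times n x edges): a random sample of
   E(G') together with about theta x edges at each high vertex and two at each low one.  Then B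
   expands small sets of high vertices by a large constant factor, and has many edges between X and
   Y whenever |X| is linear in n and |Y| >= n/3, because H removes less than a (1/3 - eps/2) fraction
   of the degree sum of X.  Consider a longest path P in a graph F between B and G', with one end
   fixed.  Rotating only towards high endpoints, t = c x rotations with c small reach a set X of
   linearly many endpoints.  A rotated path has at most t links outside P; hence, up to t exceptions
   each, the neighbours of these endpoints are neighbours on P of the set T of all possible
   endpoints.  Since F has more than t |X| edges from X to any n/3 vertices, |T| >= n/3.

   So, unless F is Hamiltonian, it has at least n/3 vertices each of which starts at least n/3
   boosters.  A union bound over the sparse graphs F inside G shows that on average more than
   (1/3 - eps/2) x boosters at such a vertex are edges of G; H cannot remove them all.
   Adding at most n + 1 boosters to B one at a time makes it Hamiltonian. *)
Require Import Defs.
From HB Require Import structures.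
From mathcomp Require Import all_boot all_order all_algebra.
From mathcomp Require Import all_classical all_reals all_analysis.
From mathcomp Require Import zify ring lra.
From mathcomp Require Import fintype finset.

Set Implicit Arguments.
Unset Strict Implicit.
Unset Printing Implicit Defensive.

Import Order.TTheory GRing.Theory Num.Theory.
Import numFieldNormedType.Exports.


(** * Rotations *)

Lemma card_bigcup_le (I T : finType) (P : pred I) (F : I -> {set T}) :
  #|\bigcup_(i | P i) F i| <= \sum_(i | P i) #|F i|.
Proof.
elim/big_rec2: _ => [|i j A _ h]; first by rewrite cards0.
by rewrite (leq_trans (leq_card_setU _ _)) // leq_add2l.
Qed.

(** * Links between consecutive vertices of a path *)

Section PathLinks.
Variable T : finType.
Implicit Types (p q a b : seq T) (x y v s : T).

(** Unordered pairs, so that reversing a segment of a path keeps its links and a rotation trades one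
    link for one other. *)
Fixpoint links p : {set {set T}} :=
  if p is x :: q then
    (if q is y :: _ then [set x; y] |: links q else set0) else set0.

Lemma links_cons x y q : links (x :: y :: q) = [set x; y] |: links (y :: q).
Proof. by []. Qed.

Lemma links_cat b y v a :
  links (rcons b y ++ v :: a) =
    links (rcons b y) :|: [set [set y; v]] :|: links (v :: a).
Proof.
elim: b => [|x b IH] /=; first by rewrite set0U.
by rewrite IH; case: b {IH} => [|z b] /=; rewrite !setUA ?setU0 // -!setUA set0U.
Qed.

Lemma links_rcons b y v :
  links (rcons (rcons b y) v) = [set y; v] |: links (rcons b y).
Proof. by rewrite -[rcons (rcons b y) v]cats1 links_cat setU0 setUC. Qed.

Lemma links_rev p : links (rev p) = links p.
Proof.
elim: p => [//|x [//|y q] IH].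
have -> : rev (x :: y :: q) = rcons (rcons (rev q) y) x by rewrite !rev_cons.
by rewrite links_rcons -rev_cons IH /= setUC [[set y; x]]setUC setUC.
Qed.

Lemma links_sub p (f : {set T}) u : f \in links p -> u \in f -> u \in p.
Proof.
elim: p => [|x [|y q] IH] /=; rewrite ?inE //.
case/orP=> [/eqP ->|/IH h uf].
  by rewrite !inE => /orP[]/eqP ->; rewrite eqxx ?orbT.
by have := h uf; rewrite inE => ->; rewrite orbT.
Qed.

Lemma links_nbr b a u v : uniq (b ++ v :: a) ->
  [set u; v] \in links (b ++ v :: a) ->
  (exists b', b = rcons b' u) \/ (exists a', a = u :: a').
Proof.
(* The case of [v] in front; a general sequence is cut just before [v]. *)
have right c w : uniq (w :: c) -> [set u; w] \in links (w :: c) ->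
    exists c', c = u :: c'.
  case: c => [|z c]; first by rewrite /= inE.
  rewrite cons_uniq links_cons in_setU1 => /andP[wc _] /orP[/eqP h|h]; last first.
    by have := links_sub h (set22 u w); rewrite (negPf wc).
  have : w != z by move: wc; rewrite inE negb_or => /andP[].
  have : u \in [set w; z] by rewrite -h set21.
  have : z \in [set u; w] by rewrite h set22.
  rewrite !inE => /orP[/eqP -> _ _|/eqP -> _]; last by rewrite eqxx.
  by exists c.
case/lastP: b => [|b y]; first by move=> /right h /h; right.
move=> uq; rewrite links_cat !inE -orbA => /or3P[h|/eqP h|h].
- have := links_sub h (set22 u v); move: uq; rewrite cat_uniq => /and3P[_ /hasPn nv _].
  by move=> hv; have := nv v; rewrite inE eqxx => /(_ isT); rewrite /= hv.
- left; exists b; congr rcons.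
  have : y != v.
    move: uq; rewrite cat_uniq => /and3P[_ /hasPn nv _].
    have := nv v; rewrite inE eqxx => /(_ isT); rewrite /= mem_rcons inE negb_or eq_sym.
    by case/andP.
  have : y \in [set u; v] by rewrite h set21.
  by rewrite !inE => /orP[/eqP ->|/eqP ->]; rewrite ?eqxx.
- move: uq; rewrite cat_uniq => /and3P[_ _ uq].
  by right; apply: right uq h.
Qed.

Lemma card_links_nbr p v : uniq p -> #|[set u | [set u; v] \in links p]| <= 2.
Proof.
move=> uq; have [vp|vp] := boolP (v \in p); last first.
  rewrite (_ : [set u | _] = set0) ?cards0 //; apply/setP => u; rewrite !inE.
  by apply/negP => h; case/negP: vp; apply: links_sub h (set22 _ _).
case/splitPr: vp uq => b a uq.
have sub : [set u | [set u; v] \in links (b ++ v :: a)] \subset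
    [set last v b; head v a].
  apply/subsetP => u; rewrite !inE => /(links_nbr uq)[[b' ->]|[a' ->]].
    by rewrite last_rcons eqxx.
  by rewrite /= eqxx orbT.
by rewrite (leq_trans (subset_leq_card sub)) // cards2; case: eqP.
Qed.

Definition link_nbrs p (S : {set T}) : {set T} :=
  \bigcup_(u in S) [set v | [set v; u] \in links p].

Lemma card_link_nbrs p S : uniq p -> #|link_nbrs p S| <= 2 * #|S|.
Proof.
move=> uq; rewrite mulnC -sum_nat_const.
apply: leq_trans (leq_sum _ (fun u _ => card_links_nbr u uq)).
exact: card_bigcup_le.
Qed.

End PathLinks.

(** * Endpoints of longest paths under rotation *)

Section Rotation.
Variables (T : finType) (e : rel T).
Hypothesis esym : symmetric e.
Hypothesis eirr : irreflexive e.
Implicit Types (p q a b : seq T) (x y v s z : T) (S : {set T}) (k : nat).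

Definition upath p := uniq p && sorted e p.

Lemma sorted_rev_sym p : sorted e p -> sorted e (rev p).
Proof. by rewrite rev_sorted (eq_sorted (_ : _ =2 e)) // => x y; rewrite esym. Qed.

Lemma upath_rev p : upath (rev p) = upath p.
Proof.
rewrite /upath rev_uniq; congr (_ && _); apply/idP/idP; last exact: sorted_rev_sym.
by move/sorted_rev_sym; rewrite revK.
Qed.

(** The Posa rotation: the segment from [s] to [y] is reversed and [s] is joined to [v], which makes
    [y] the new endpoint. Writing [s] as [head y b] includes the case of empty [b], where
    [s = y]. *)
Lemma upath_rotate s b y v a : upath (rcons b y ++ v :: a) ->
  s = head y b -> e s v -> upath (rev (rcons b y) ++ v :: a).
Proof.
rewrite /upath => /andP[uq so] hs sv; apply/andP; split.
  move: uq; rewrite !cat_uniq rev_uniq => /and3P[-> h ->]; rewrite andTb andbT.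
  by rewrite (eq_has (_ : _ =1 mem (rcons b y))) // => x; apply: mem_rev.
case: b uq so hs => [|x b] /= uq so hs; first by move: so => /=; rewrite -hs /= sv.
subst x; move: so; rewrite cat_path last_rcons => /and3P[so yv va].
rewrite rev_cons rev_rcons /=.
rewrite cat_path last_rcons /= sv (va : path e v a) !andbT.
have : sorted e (rev (s :: rcons b y)) by apply: sorted_rev_sym.
by rewrite rev_cons rev_rcons.
Qed.

Lemma links_rotate s b y v a : s = head y b ->
  links (rev (rcons b y) ++ v :: a) =
    links (rcons b y) :|: [set [set s; v]] :|: links (v :: a).
Proof.
case: b => [|x b] -> /=; first by rewrite set0U.
by rewrite rev_cons links_cat -rev_cons links_rev.
Qed.

Variable L : nat.
Hypothesis Lmax : forall p, upath p -> size p <= L.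

(** Otherwise [v] could be put in front of [s], giving a longer path. *)
Lemma longest_nbr s q v : upath (s :: q) -> size (s :: q) = L -> e s v -> v \in q.
Proof.
move=> up sz sv; have [//|nv] := boolP (v \in q); exfalso.
have vs : v != s by apply: contraTneq sv => ->; rewrite eirr.
have : upath (v :: s :: q).
  by move: up; rewrite /upath /= inE negb_or vs nv esym sv => /andP[-> ->].
by move=> /Lmax; rewrite /= -sz /= ltnn.
Qed.

Lemma path_split s q v : v \in q -> exists b y a, s :: q = rcons b y ++ v :: a /\ s = head y b.
Proof.
case/splitPr => b a; case/lastP: b => [|b y]; first by exists [::], s, a.
by exists (s :: b), y, a.
Qed.

Variables (high : pred T).
Hypothesis few_low2 : forall s, high s ->
  #|[set v | e s v && [exists y, [&& y != s, e v y & ~~ high y]]]| <= 1.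

Definition nbrs (S : {set T}) : {set T} := \bigcup_(u in S) [set v | e u v].

Section FixedPath.
Variables (s0 : T) (q0 : seq T).
Let P := s0 :: q0.
Let z := last s0 q0.
Hypothesis upP : upath P.
Hypothesis szP : size P = L.

(** The fourth clause tells which links at a pivot are still those of [P]; the fifth bounds the
    number of exceptional neighbours in [nbr_link_nbrs]. *)
Definition rotated (S : {set T}) k s q :=
  [/\ upath (s :: q), perm_eq (s :: q) P, last s q = z,
      forall f, f \in links P -> (forall u, u \in S -> u \notin f) -> f \in links (s :: q)
    & #|links (s :: q) :\: links P| <= k].

Definition reached (S : {set T}) k :=
  forall s, s \in S -> high s /\ exists q, rotated S k s q.

Lemma reached0 : high s0 -> reached [set s0] 0.
Proof.
move=> h s /set1P ->; split=> //; exists q0; split => //.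
by rewrite setDv cards0.
Qed.

Lemma rotated_size S k s q : rotated S k s q -> size (s :: q) = L.
Proof. by case=> _ /perm_size -> _ _ _. Qed.

(** Neither [v] nor its neighbours on [P] lie in [S], so the links of [P] at [v] are still present.
    Rotating at [v] therefore yields an endpoint [y] that is next to [v] on [P] itself. *)
Lemma reached_step_aux S k s q v : s0 \in S -> s \in S -> rotated S k s q ->
  e s v -> v \notin S -> v \notin link_nbrs P S ->
  exists y r, [/\ e v y, y != s, [set v; y] \in links P & rotated (y |: S) k.+1 y r].
Proof.
move=> s0S sS rot sv vS vl; have [up pq lq keep brk] := rot.
have vq := longest_nbr up (rotated_size rot) sv.
have [b [y [a [E hs]]]] := path_split s vq.
have vP : v \in P by rewrite -(perm_mem pq) inE vq orbT.
have uqP : uniq P by case/andP: upP.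
have uqQ : uniq (rcons b y ++ v :: a) by rewrite -E; case/andP: up.
have vs0 : v != s0 by apply: contraNneq vS => ->.
have keepv u : [set u; v] \in links P -> [set u; v] \in links (s :: q).
  move=> h; apply: keep => // w wS; apply/negP; rewrite !inE => /orP[]/eqP ew; last first.
    by case/negP: vS; rewrite -ew.
  case/negP: vl; apply/bigcupP; exists u; first by rewrite -ew.
  by rewrite inE setUC.
(* The link from [v] to its predecessor [w] on [P] survives. If it runs to the right of [v] on the
   current path, then [v] is not the common last vertex [z], so [v] has a successor [w'] on [P]; the
   surviving link to [w'] must then be the one on the left. *)
have yP : [set y; v] \in links P.
  have vq0 : v \in q0 by move: vP; rewrite inE (negPf vs0).
  have [b1 [w [a1 [EP _]]]] := path_split s0 vq0.
  have wP : [set w; v] \in links P by rewrite /P EP links_cat !inE eqxx orbT.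
  have := keepv _ wP; rewrite E => /(links_nbr uqQ)[[b' /rcons_inj[_ ->]] //|[a' Ea]].
  case: a1 EP => [|w' a1] EP.
    have zv : z = v by rewrite /z -[last _ _]/(last s0 P) /P EP last_cat.
    move: lq; rewrite zv -[last s q]/(last s (s :: q)) E last_cat Ea /= => lv.
    move: uqQ; rewrite cat_uniq Ea /= => /and3P[_ _ /andP[h _]].
    by move: h; rewrite -{1}lv mem_last.
  have w'P : [set w'; v] \in links P.
    by rewrite /P EP links_cat /= !inE setUC eqxx ?orbT.
  have := keepv _ w'P; rewrite E => /(links_nbr uqQ)[[b' /rcons_inj[_ ->]] //|[a'' Ea']].
  move: Ea'; rewrite Ea => -[ww _]; exfalso; move: uqP; rewrite /P EP ww.
  rewrite cat_uniq => /and3P[_ /hasPn h _].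
  by have := h w'; rewrite !inE eqxx orbT mem_rcons inE eqxx => /(_ isT).
have ev : e v y.
  move: up; rewrite E => /andP[_]; case: {E hs uqQ} b => [|x b] /=; first by rewrite esym; case/andP.
  by rewrite cat_path last_rcons /= => /and3P[_]; rewrite esym.
have ys : y != s.
  apply: contraNneq vl => ys; apply/bigcupP; exists s => //.
  by rewrite inE setUC -ys.
exists y, (rev b ++ v :: a).
have eR : y :: rev b ++ v :: a = rev (rcons b y) ++ v :: a by rewrite rev_rcons.
split=> //; first by rewrite setUC.
have lR := links_rotate v a hs.
split.
- by rewrite eR; apply: (upath_rotate _ hs sv); rewrite -E.
- by rewrite eR -(permPr pq) E perm_cat2r perm_rev.
- rewrite last_cat /=; move: lq; rewrite -[last s q]/(last s (s :: q)) E last_cat //.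
- move=> f fP av; have : f \in links (s :: q).
    by apply: keep => // u uS; apply: av; rewrite !inE uS orbT.
  rewrite eR lR E links_cat !inE -!orbA => /or3P[->|/eqP fe|->]; rewrite ?orbT //.
  by have := av y; rewrite fe !inE !eqxx => /(_ isT).
- rewrite eR lR; apply: leq_trans (_ : #|[set s; v] |: (links (s :: q) :\: links P)| <= _).
    apply: subset_leq_card; apply/subsetP => f; rewrite E links_cat !inE -!orbA.
    by case/andP=> ->; case/or3P=> ->; rewrite ?orbT.
  by rewrite cardsU1 -[k.+1]addn1 addnC leq_add //; case: (_ \notin _).
Qed.

(* Rotations are restricted to those whose new endpoint is high; each vertex [v] discarded for
   leading to a low endpoint has a low neighbour, so there is at most one per element of [S]. *)
Lemma reached_step S k : s0 \in S -> reached S k ->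
  exists S', [/\ S \subset S', reached S' k.+1
               & #|nbrs S :\: S| <= 2 * #|S'| + 3 * #|S|].
Proof.
move=> s0S rS.
pose okP y := high y /\ exists r, rotated (y |: S) k.+1 y r.
pose Y : {set T} := [set y | `[< okP y >]].
pose lowv s : {set T} := [set v | e s v && [exists y, [&& y != s, e v y & ~~ high y]]].
exists (S :|: Y); split; first exact: subsetUl.
  (* The invariant weakens as the set grows, so the sets [y |: S] of the single rotations can all be
     replaced by [S :|: Y]. *)
  have mono s q j (A : {set T}) : rotated A j s q -> A \subset S :|: Y -> j <= k.+1 ->
      rotated (S :|: Y) k.+1 s q.
    case=> h1 h2 h3 h4 h5 sA jk; split=> //; last exact: leq_trans h5 jk.
    by move=> f fP av; apply: h4 => // u uA; apply: av; apply: (subsetP sA).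
  move=> s; rewrite inE => /orP[/rS[hs [q rq]]|sY].
    by split=> //; exists q; apply: mono rq _ _; rewrite ?subsetUl.
  have := sY; rewrite inE => /asboolP[hs [q rq]]; split=> //; exists q.
  apply: mono rq _ _ => //; rewrite subUset subsetUl andbT sub1set inE sY.
  by rewrite orbT.
(* A neighbour [v] outside [S] is next to [S] on [P] (at most [2|S|] such), or is discarded (at most
   [|S|]), or is next on [P] to a new endpoint (at most [2|Y|]). *)
have sub : nbrs S :\: S \subset
    link_nbrs P S :|: (\bigcup_(s in S) lowv s) :|: link_nbrs P Y.
  apply/subsetP => v; rewrite !inE => /andP[vS /bigcupP[s sS]].
  rewrite inE => sv; apply/orP; case: (boolP (v \in link_nbrs P S)) => [vl|vl] /=; first by left.
  have [hs [q rq]] := rS _ sS.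
  have [y [r [vy ys yP rr]]] := reached_step_aux s0S sS rq sv vS vl.
  case: (boolP (high y)) => hy.
    right; apply/bigcupP; exists y; rewrite inE //.
    by apply/asboolP; split=> //; exists r.
  left; apply/bigcupP; exists s; rewrite // inE sv.
  by apply/existsP; exists y; rewrite ys vy hy.
apply: leq_trans (subset_leq_card sub) _.
have uqP : uniq P by case/andP: upP.
have c1 := card_link_nbrs S uqP; have c2 := card_link_nbrs Y uqP.
have c3 : #|\bigcup_(s in S) lowv s| <= #|S|.
  rewrite -[X in _ <= X]sum1_card.
  apply: leq_trans (card_bigcup_le _ _) _.
  by apply: leq_sum => s /rS[hs _]; apply: few_low2.
have c4 : #|Y| <= #|S :|: Y| by apply: subset_leq_card; apply: subsetUr.
have c5 := (leq_card_setU (link_nbrs P S :|: \bigcup_(s in S) lowv s) (link_nbrs P Y)).1.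
have c6 := (leq_card_setU (link_nbrs P S) (\bigcup_(s in S) lowv s)).1.
lia.
Qed.

Definition path_ends : {set T} :=
  [set x | `[< exists q, [/\ upath (x :: q), size (x :: q) = L & last x q = z] >]].

(* A neighbour [v] of [x] yields the new endpoint preceding [v] on the rotated path; unless the
   link to it is one of the [k] new ones, this puts [v] next to that endpoint on [P]. *)
Lemma nbr_link_nbrs S k x : reached S k -> x \in S ->
  #|[set v | e x v] :\: link_nbrs P path_ends| <= k.
Proof.
move=> rS xS; have [_ [q rq]] := rS _ xS; have [up pq lq _ brk] := rq.
apply: leq_trans brk.
have uqQ : uniq (x :: q) by case/andP: up.
(* The predecessor of [v] on the rotated path; a neighbour [v] of [x] is never its first vertex. *)
pose pr v := nth x (x :: q) (index v (x :: q)).-1.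
have key v : e x v -> [/\ [set pr v; v] \in links (x :: q), pr v \in path_ends &
    index (pr v) (x :: q) < index v (x :: q)].
  move=> xv; have vq := longest_nbr up (rotated_size rq) xv.
  have [b [y [a [E hx]]]] := path_split x vq.
  have vn : v \notin rcons b y.
    move: uqQ; rewrite E cat_uniq => /and3P[_ /hasPn h _]; apply: h.
    by rewrite inE eqxx.
  have iv : index v (x :: q) = (size b).+1.
    by rewrite E index_cat (negPf vn) /= eqxx size_rcons addn0.
  have prv : pr v = y.
    by rewrite /pr iv /= E nth_cat size_rcons leqnn nth_rcons ltnn eqxx.
  rewrite prv; split.
  - by rewrite E links_cat !inE eqxx orbT.
  - rewrite inE; apply/asboolP; exists (rev b ++ v :: a).
    have eR : y :: rev b ++ v :: a = rev (rcons b y) ++ v :: a by rewrite rev_rcons.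
    split.
    + by rewrite eR; apply: (upath_rotate _ hx xv); rewrite -E.
    + rewrite eR size_cat size_rev -size_cat -E; exact: rotated_size rq.
    + rewrite last_cat /=; move: lq; rewrite -[last x q]/(last x (x :: q)) E last_cat //.
  - rewrite iv E index_cat mem_rcons inE eqxx /= -cats1 index_cat.
    have yb : y \notin b.
      by move: uqQ; rewrite E cat_uniq rcons_uniq => /and3P[/andP[]].
    by rewrite (negPf yb) /= eqxx addn0.
(* Each exceptional [v] is charged to the link before it, which is new. The charge is injective
   because the later end of a link determines it. *)
rewrite -(card_in_imset (f := fun v => [set pr v; v])).
  apply: subset_leq_card; apply/subsetP => f /imsetP[v]; rewrite !inE => /andP[vl xv] ->.
  have [h1 h2 _] := key _ xv; rewrite h1 andbT; apply: contra vl => h.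
  by apply/bigcupP; exists (pr v) => //; rewrite inE setUC.
move=> v w; rewrite !inE => /andP[_ /key[_ _ lv]] /andP[_ /key[_ _ lw]] E.
have : v \in [set pr w; w] by rewrite -E set22.
rewrite !inE => /orP[/eqP Ev|/eqP //].
have : w \in [set pr v; v] by rewrite E set22.
rewrite !inE => /orP[/eqP Ew|/eqP //].
by move: lv lw; rewrite -Ew -Ev => l1 l2; have := ltn_trans l1 l2; rewrite ltnn.
Qed.

End FixedPath.

Variables (D1 K t : nat).
Hypothesis expand : forall U : {set T}, (forall u, u \in U -> high u) -> #|U| <= D1 ->
  (2 * K + 3) * #|U| <= #|nbrs U :\: U|.
Hypothesis dense : forall X B : {set T}, D1 < #|X| -> #|T| <= 3 * #|B| ->
  exists2 x, x \in X & t < #|[set v | e x v] :&: B|.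
Hypothesis Kt : #|T| < K ^ t.
Hypothesis mindeg2 : forall v, 1 < #|[set u | e v u]|.
Hypothesis low_nbr_uniq : forall v y y', e v y -> e v y' -> ~~ high y -> ~~ high y' -> y = y'.

(** While [|S| <= D1], expansion gives [(2K + 3)|S| <= 2|S'| + 3|S|], so each step multiplies the
    size by at least [K]. After [t] steps it would exceed [|T|]. *)
Lemma reached_large s0 q0 : upath (s0 :: q0) -> size (s0 :: q0) = L -> high s0 ->
  exists2 S, reached s0 q0 S t & D1 < #|S|.
Proof.
move=> up sz hs.
have [S [_ rS [h|//]]] : exists S, [/\ s0 \in S, reached s0 q0 S t & K ^ t <= #|S| \/ D1 < #|S|].
  elim: t => [|j [S [s0S rS hS]]].
    by exists [set s0]; split; [exact: set11|exact: reached0|left; rewrite cards1].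
  have [S' [sS rS' cS]] := reached_step up sz s0S rS.
  exists S'; split=> //; first exact: (subsetP sS).
  have sc := subset_leq_card sS.
  case: (leqP #|S| D1) => hD; last by right; apply: leq_trans sc.
  case: hS => hS; last by right; apply: leq_trans sc.
  left; have /expand -/(_ hD) ex : forall u, u \in S -> high u by move=> u /rS[].
  rewrite expnS; have : K * #|S| <= #|S'| by lia.
  by apply: leq_trans; rewrite leq_mul2l hS orbT.
by have := leq_trans Kt (leq_trans h (max_card _)); rewrite ltnn.
by exists S.
Qed.

(** If there were fewer than [|T|/3] endpoints, their neighbours on [P] would leave at least [|T|/3]
    vertices uncovered. By [dense] some reached endpoint has more than [t] neighbours there, against
    [nbr_link_nbrs]. *)
Lemma many_ends_high s0 q0 : upath (s0 :: q0) -> size (s0 :: q0) = L -> high s0 ->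
  #|T| <= 3 * #|path_ends s0 q0|.
Proof.
move=> up sz hs; have [S rS cS] := reached_large up sz hs.
rewrite leqNgt; apply/negP => lt.
have uq : uniq (s0 :: q0) by case/andP: up.
set Q := link_nbrs (s0 :: q0) (path_ends s0 q0).
have cQ : #|Q| <= 2 * #|path_ends s0 q0| by apply: card_link_nbrs.
have hB : #|T| <= 3 * #|~: Q| by have := cardsC Q; lia.
have [x xS] := dense cS hB.
by rewrite -setDE ltnNge (nbr_link_nbrs sz rS).
Qed.

(** From a low endpoint one rotation leads to a high one: its pivot [v] already has the low
    neighbour [s0], so the new endpoint, another neighbour of [v], is high. The far end is
    unchanged, hence so is the set of endpoints. *)
Lemma many_ends s0 q0 : upath (s0 :: q0) -> size (s0 :: q0) = L ->
  #|T| <= 3 * #|path_ends s0 q0|.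
Proof.
move=> up sz; have [hs|ls] := boolP (high s0); first exact: many_ends_high.
(* The pivot must differ from the second vertex, as otherwise the rotation would return [s0]. *)
have [v] : exists v, v \in [set u | e s0 u] :\ head s0 q0.
  apply/set0Pn; rewrite -card_gt0.
  by have := cardsD1 (head s0 q0) [set u | e s0 u]; have := mindeg2 s0; case: (_ \in _); lia.
rewrite !inE => /andP[vh sv].
have vq := longest_nbr up sz sv.
have [b [y [a [E hx]]]] := path_split s0 vq.
have eR : y :: rev b ++ v :: a = rev (rcons b y) ++ v :: a by rewrite rev_rcons.
have vy : e v y.
  move: up; rewrite E => /andP[_]; case: {E hx eR} b => [|x b] /=; first by rewrite esym; case/andP.
  by rewrite cat_path last_rcons /= => /and3P[_]; rewrite esym.
have ys : y != s0.
  case: b E hx {eR} => [|w b] E hx.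
    by case: E => _ E; move: vh; rewrite E /= eqxx.
  have : uniq (s0 :: q0) by case/andP: up.
  rewrite E cat_uniq rcons_uniq => /and3P[/andP[h _] _ _].
  by apply: contraNneq h => ->; rewrite hx /= inE eqxx.
have hy : high y.
  apply/negPn/negP => ly; move: ys; rewrite (low_nbr_uniq vy _ ly ls) ?eqxx //.
  by rewrite esym.
have up' : upath (y :: rev b ++ v :: a).
  by rewrite eR; apply: (upath_rotate _ hx sv); rewrite -E.
have sz' : size (y :: rev b ++ v :: a) = L.
  by rewrite eR size_cat size_rev -size_cat -E.
have := many_ends_high up' sz' hy.
have lE : last y (rev b ++ v :: a) = last s0 q0.
  by rewrite -[last s0 q0]/(last s0 (s0 :: q0)) E !last_cat.
by rewrite /path_ends lE.
Qed.

(** Connectivity. The high vertices [U] of a closed set have only low neighbours outside [U], at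
    most one each, which contradicts expansion unless [|U| > D1]. If a set and its complement are
    both closed, both are thus large, one has at least a third of the vertices, and [dense] gives an
    edge between them. *)
Lemma closed_setT (C : {set T}) : C != set0 ->
  (forall u v, u \in C -> e u v -> v \in C) -> C = setT.
Proof.
have big (A : {set T}) : A != set0 -> (forall u v, u \in A -> e u v -> v \in A) -> D1 < #|A|.
  move=> A0 cl; pose U := [set u in A | high u].
  have U0 : 0 < #|U|.
    have [y yA] := set0Pn _ A0; rewrite card_gt0.
    have [hy|ly] := boolP (high y); first by apply/set0Pn; exists y; rewrite inE yA.
    have [v [w [vw yv yw]]] : exists v w, [/\ v != w, e y v & e y w].
      have [v] : exists v, v \in [set u | e y u].
        by apply/set0Pn; rewrite -card_gt0; apply: ltnW.
      rewrite inE => yv.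
      have [w] : exists w, w \in [set u | e y u] :\ v.
        apply/set0Pn; rewrite -card_gt0; have := mindeg2 y.
        by rewrite (cardsD1 v) inE yv.
      by rewrite !inE => /andP[wv yw]; exists v, w; rewrite eq_sym.
    apply/set0Pn; case: (boolP (high v)) => hv.
      by exists v; rewrite inE hv (cl y).
    exists w; rewrite inE (cl y) //=; apply/negPn/negP => hw.
    by move: vw; rewrite (low_nbr_uniq yv yw) ?eqxx.
  have sUA : #|U| <= #|A| by apply: subset_leq_card; apply/subsetP => u; rewrite inE => /andP[].
  rewrite ltnNge; apply/negP => /(leq_trans sUA) hD.
  have := expand _ hD; have hU u : u \in U -> high u by rewrite inE => /andP[].
  move=> /(_ hU).
  have : #|nbrs U :\: U| <= #|U|.
    pose lo u : {set T} := [set v | e u v && ~~ high v].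
    apply: leq_trans (_ : #|\bigcup_(u in U) lo u| <= _).
      apply: subset_leq_card; apply/subsetP => v; rewrite !inE => /andP[nv /bigcupP[u uU]].
      rewrite inE => uv; apply/bigcupP; exists u; rewrite // inE uv.
      apply: contra nv => ->; rewrite andbT; apply: cl uv.
      by move: uU; rewrite inE => /andP[].
    rewrite -[X in _ <= X]sum1_card; apply: leq_trans (card_bigcup_le _ _) _.
    apply: leq_sum => u _; apply/card_le1_eqP => v w; rewrite !inE => /andP[uv lv] /andP[uw lw].
    exact: (low_nbr_uniq uw uv lw lv).
  lia.
move=> C0 cl; apply/eqP; apply/negPn/negP => nC.
have C0' : ~: C != set0 by rewrite -setCT (inj_eq (@setC_inj _)).
have cl' u v : u \in ~: C -> e u v -> v \in ~: C.
  by rewrite !inE => nu uv; apply: contra nu => vC; apply: cl vC _; rewrite esym.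
have b1 := big _ C0 cl; have b2 := big _ C0' cl'.
have := cardsC C => cc.
have [h|h] := leqP #|C| #|~: C|.
  have [|x xC] := dense b1 (B := ~: C); first by lia.
  have -> : [set v | e x v] :&: ~: C = set0; last by rewrite cards0.
  apply/setP => v; rewrite !inE; apply/andP => -[xv]; case/negP.
  exact: cl xv.
have [|x xC] := dense b2 (B := C); first by lia.
have -> : [set v | e x v] :&: C = set0; last by rewrite cards0.
apply/setP => v; rewrite !inE; apply/andP => -[xv vC].
by have := cl' _ _ xC xv; rewrite inE vC.
Qed.

End Rotation.

Lemma upath_sub (T : finType) (e e' : rel T) p : subrel e e' -> upath e p -> upath e' p.
Proof. by move=> h /andP[uq so]; rewrite /upath uq (sub_sorted h). Qed.

(** The ends of the path are adjacent and close a cycle. If it misses a vertex, connectivity gives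
    an edge leaving it; cutting the cycle at that edge gives a longer path. *)
Lemma cycle_extend (T : finType) (e : rel T) x q : symmetric e ->
  (forall C : {set T}, C != set0 -> (forall u v, u \in C -> e u v -> v \in C) -> C = setT) ->
  upath e (x :: q) -> e x (last x q) ->
  (size (x :: q) = #|T| /\ ucycleb e (x :: q)) \/
  exists2 p, upath e p & size p = (size (x :: q)).+1.
Proof.
move=> es con /andP[uq so] cl.
have cy : cycle e (x :: q) by rewrite /= rcons_path -/(sorted e (x :: q)) so es.
pose C := [set u in x :: q].
have [h|] := boolP [forall u, [forall v, (u \in C) && e u v ==> (v \in C)]].
  left; split; last by rewrite /ucycleb uq cy.
  have CT : C = setT.
    apply: con; first by apply/set0Pn; exists x; rewrite !inE eqxx.
    by move=> u v uC uv; move/forallP/(_ u)/forallP/(_ v): h; rewrite uC uv.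
  by rewrite -cardsT -CT cardsE (card_uniqP uq).
case/forallPn=> u /forallPn[v]; rewrite negb_imply inE => /andP[/andP[uC uv] vC].
right; case/rot_to: uC cy uq => i r E cy uq.
exists (v :: u :: r); last by rewrite -(size_rot i (x :: q)) E.
have uqr : uniq (u :: r) by rewrite -E rot_uniq.
have vr : v \notin u :: r by rewrite -E mem_rot; move: vC; rewrite inE.
rewrite /upath cons_uniq uqr vr /=.
have : cycle e (u :: r) by rewrite -E rot_cycle.
by rewrite /= rcons_path (es v u) uv => /andP[].
Qed.

Local Open Scope ring_scope.

(** * Random subsets *)

Section RandomSubset.
Variables (R : realType) (T : finType) (E : {set T}) (p : R).
Hypothesis p01 : 0 <= p <= 1.
Implicit Types (A B : pred {set T}) (J F : {set T}).

Definition rs_mass J : R := \prod_(e in E) (if e \in J then p else 1 - p).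

Definition rs_prob A : R := \sum_(J : {set T} | (J \subset E) && A J) rs_mass J.

Lemma rs_sum_prod (f g : T -> R) :
  \sum_(J : {set T} | J \subset E) \prod_(e in E) (if e \in J then f e else g e) =
  \prod_(e in E) (f e + g e).
Proof.
rewrite [RHS]big_mkcond /=.
(* Outside [E] the factors 0 and 1 remove exactly the sets [J] that are not contained in [E]. *)
transitivity (\prod_e ((if e \in E then f e else 0) + (if e \in E then g e else 1))); last first.
  by apply: eq_bigr => e _; case: ifP => // _; rewrite add0r.
rewrite bigA_distr big_mkcond /=; apply: eq_bigr => J _.
case: ifPn => [sJ|/subsetPn[e eJ eE]]; last first.
  by rewrite (bigD1 e) //= eJ (negPf eE) mul0r.
rewrite big_mkcond /=; apply: eq_bigr => e _; case: ifPn => eE; first by case: ifP.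
by case: ifP => // /(subsetP sJ); rewrite (negPf eE).
Qed.

Lemma rs_mass_ge0 J : 0 <= rs_mass J.
Proof. by apply: prodr_ge0 => e _; case: ifP => _; move: p01; lra. Qed.

Lemma rs_prob_ge0 A : 0 <= rs_prob A.
Proof. by apply: sumr_ge0 => J _; apply: rs_mass_ge0. Qed.

Lemma rs_total : rs_prob predT = 1.
Proof.
rewrite /rs_prob (eq_bigl (fun J => J \subset E)); last by move=> J; rewrite andbT.
rewrite (rs_sum_prod (fun=> p) (fun=> 1 - p)) big1 // => e _; lra.
Qed.

Lemma rs_compl A : rs_prob A + rs_prob (predC A) = 1.
Proof. by rewrite -rs_total [RHS](bigID A) /= ; congr (_ + _); apply: eq_bigl => J; rewrite andbT. Qed.

Lemma rs_le A B : (forall J, J \subset E -> A J -> B J) -> rs_prob A <= rs_prob B.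
Proof.
move=> AB; rewrite /rs_prob big_mkcond [leRHS]big_mkcond /=.
apply: ler_sum => J _; case: ifPn => [/andP[sJ aJ]|_]; first by rewrite sJ AB.
by case: ifP => // _; apply: rs_mass_ge0.
Qed.

Lemma rs_union (I : finType) (A : I -> pred {set T}) :
  rs_prob (fun J => [exists i, A i J]) <= \sum_i rs_prob (A i).
Proof.
rewrite /rs_prob; under [leRHS]eq_bigr do rewrite big_mkcond.
rewrite exchange_big /= big_mkcond /=; apply: ler_sum => J _.
have nn i : 0 <= (if (J \subset E) && A i J then rs_mass J else 0).
  by case: ifP => // _; apply: rs_mass_ge0.
case: ifPn => [/andP[sJ /existsP[i aJ]]|_]; last by apply: sumr_ge0.
by rewrite (bigD1 i) //= {1}sJ aJ /= lerDl; apply: sumr_ge0.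
Qed.

(** Markov's inequality for a product variable, whose expectation factorises by independence. *)
Lemma rs_markov A (c : R) (f g : T -> R) : 0 <= c ->
  (forall e, 0 <= f e) -> (forall e, 0 <= g e) ->
  (forall J, J \subset E -> A J -> 1 <= c * \prod_(e in E) (if e \in J then f e else g e)) ->
  rs_prob A <= c * \prod_(e in E) (p * f e + (1 - p) * g e).
Proof.
move=> c0 f0 g0 h; rewrite -rs_sum_prod mulr_sumr.
have q0 : 0 <= 1 - p by move: p01; lra.
have p0 : 0 <= p by case/andP: p01.
have mE J : \prod_(e in E) (if e \in J then p * f e else (1 - p) * g e) =
    rs_mass J * \prod_(e in E) (if e \in J then f e else g e).
  by rewrite -big_split /=; apply: eq_bigr => e _; case: ifP.
rewrite /rs_prob big_mkcond [leRHS]big_mkcond /=; apply: ler_sum => J _.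
case: (boolP (J \subset E)) => [sJ|_] /=; last exact: lexx.
have nn : 0 <= \prod_(e in E) (if e \in J then f e else g e).
  by apply: prodr_ge0 => e _; case: ifP.
rewrite mE mulrCA; case: ifPn => aJ; last by rewrite !mulr_ge0 ?rs_mass_ge0.
by rewrite ler_peMr ?rs_mass_ge0 ?h.
Qed.

(** Exponential moments, with [s] of either sign so as to serve both tails. The factor 0 for a
    missing element of [F] encodes [F \subset J]; elsewhere [1 + y <= expR y] bounds each factor. *)
Lemma rs_tail (s k : R) (w : T -> R) F : F \subset E ->
  rs_prob (fun J => (F \subset J) && (s * k <= s * \sum_(e in J :\: F) w e)) <=
  p ^+ #|F| * expR (- (s * k) + p * \sum_(e in E :\: F) (expR (s * w e) - 1)).
Proof.
move=> sF.
pose f e := if e \in F then 1 else expR (s * w e).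
pose g e : R := if e \in F then 0 else 1.
apply: (le_trans (@rs_markov _ (expR (- (s * k))) f g _ _ _ _)).
- exact: expR_ge0.
- by move=> e; rewrite /f; case: ifP => // _; apply: expR_ge0.
- by move=> e; rewrite /g; case: ifP.
- move=> J sJ /andP[FJ hk].
  have -> : \prod_(e in E) (if e \in J then f e else g e) =
      expR (s * \sum_(e in J :\: F) w e).
    rewrite mulr_sumr expR_sum big_mkcond [RHS]big_mkcond /=.
    apply: eq_bigr => e _; rewrite inE /f /g.
    case: (boolP (e \in F)) => eF /=; first by rewrite (subsetP FJ) //; case: ifP.
    by case: (boolP (e \in J)) => [/(subsetP sJ) ->|_] //; case: ifP.
  by rewrite -expRD -expR0 ler_expR addrC subr_ge0.
rewrite expRD mulrCA ler_wpM2l ?expR_ge0 //.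
have p0 : 0 <= p by case/andP: p01.
have q0 : 0 <= 1 - p by move: p01; lra.
have fg0 e : 0 <= p * f e + (1 - p) * g e.
  rewrite addr_ge0 ?mulr_ge0 //; first by rewrite /f; case: ifP => // _; apply: expR_ge0.
  by rewrite /g; case: ifP.
rewrite (bigID (mem F)) /= ler_pM ?prodr_ge0 //.
- rewrite (eq_bigl (mem F)); last first.
    by move=> e /=; case: (boolP (e \in F)) => [/(subsetP sF) ->|]; rewrite ?andbF.
  rewrite (eq_bigr (fun=> p)) ?prodr_const //.
  by move=> e /= eF; rewrite /f /g eF mulr0 addr0 mulr1.
- rewrite mulr_sumr expR_sum (eq_bigl (mem (E :\: F))); last first.
    by move=> e; rewrite !inE andbC.
  apply: ler_prod => e; rewrite !inE => /andP[eF _]; rewrite /f /g (negPf eF) mulr1.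
  rewrite addr_ge0 ?mulr_ge0 ?expR_ge0 //=.
  by apply: le_trans (expR_ge1Dx _); rewrite mulrBr mulr1; lra.
Qed.

Lemma expRN_le (y : R) : 0 <= y -> expR (- y) <= 1 - y + y ^+ 2.
Proof.
move=> y0; rewrite expRN; have h := expR_ge1Dx y.
have y1 : 0 < 1 + y by lra.
apply: (le_trans (_ : _ <= (1 + y)^-1)); first by rewrite lef_pV2 ?posrE ?expR_gt0.
rewrite -div1r ler_pdivrMr //.
by have := mulr_ge0 y0 (mulr_ge0 y0 y0); rewrite expr2; nra.
Qed.

Lemma expR_le_quad (y : R) : 0 <= y -> y <= 2^-1 -> expR y <= 1 + y + 2 * y ^+ 2.
Proof.
move=> y0 y1; have h := expR_ge1Dx (- y).
have y2 : 0 < 1 - y by lra.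
rewrite -[y in expR y]opprK expRN.
apply: (le_trans (_ : _ <= (1 - y)^-1)); first by rewrite lef_pV2 ?posrE ?expR_gt0.
rewrite -div1r ler_pdivrMr // expr2.
have := mulr_ge0 (mulr_ge0 y0 y0) (_ : 0 <= 1 - 2 * y); have : 0 <= 1 - 2 * y by lra.
by move=> h1 /(_ h1); nra.
Qed.

Lemma rs_lower (a : R) (w : T -> nat) F : F \subset E ->
  (forall e, (w e <= 2)%N) -> (forall e, e \in F -> w e = 0%N) -> 0 <= a <= 1 ->
  rs_prob (fun J => (F \subset J) &&
     ((\sum_(e in J) w e)%:R <= (1 - a) * p * (\sum_(e in E) w e)%:R)) <=
  p ^+ #|F| * expR (- (a ^+ 2 / 8) * p * (\sum_(e in E) w e)%:R).
Proof.
move=> sF w2 wF a01; set W := (\sum_(e in E) w e)%:R.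
have p0 : 0 <= p by case/andP: p01.
have WE : W = \sum_(e in E :\: F) (w e)%:R.
  rewrite /W natr_sum (big_setID F) /= big1 ?add0r //.
  by move=> e; rewrite inE => /andP[_ /wF ->].
have JE J : F \subset J -> (\sum_(e in J) w e)%:R = \sum_(e in J :\: F) (w e)%:R :> R.
  move=> FJ; rewrite natr_sum (big_setID F) /= big1 ?add0r //.
  by move=> e; rewrite inE => /andP[_ /wF ->].
(* Since [w <= 2] gives [w^2 <= 2w], the choice [s = - a/4] yields the rate
   [- a^2/4 + a^2/8 = - a^2/8]. *)
apply: le_trans (le_trans (rs_tail (- (a / 4)) ((1 - a) * p * W) (fun e => (w e)%:R) sF) _).
  apply: rs_le => J _ /andP[FJ]; rewrite FJ JE // => h /=.
  by rewrite !mulNr lerN2 ler_wpM2l //; lra.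
rewrite ler_wpM2l ?exprn_ge0 // ler_expR.
apply: (le_trans (_ : _ <= a / 4 * ((1 - a) * p * W) + p * (- (a / 4 - a ^+ 2 / 8) * W))).
  rewrite mulNr opprK lerD2l ler_wpM2l // WE mulr_sumr; apply: ler_sum => e _.
  have := @expRN_le (a / 4 * (w e)%:R); rewrite mulNr mulr_ge0 //; last by lra.
  move=> /(_ isT); move: (w2 e); case: (w e) => [|[|[|//]]] _; rewrite ?mulr0 ?oppr0 ?expR0; nra.
have W0 : 0 <= W by rewrite /W ler0n.
have := mulr_ge0 p0 W0; nra.
Qed.

(** [W] need only bound the total weight, since pairs [(u, u)] count in the size of a set of ordered
    pairs but are never edges. With [s = a/8] the rate is [- a^2/8 + a^2/16]. *)
Lemma rs_upper (a : R) (w : T -> nat) (W : R) :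
  (forall e, (w e <= 2)%N) -> (\sum_(e in E) w e)%:R <= W -> 0 <= a <= 1 ->
  rs_prob (fun J => (1 + a) * p * W <= (\sum_(e in J) w e)%:R) <=
  expR (- (a ^+ 2 / 16) * p * W).
Proof.
move=> w2 WE a01.
have p0 : 0 <= p by case/andP: p01.
have W0 : 0 <= W by apply: le_trans WE; rewrite ler0n.
have := rs_tail (a / 8) ((1 + a) * p * W) (fun e => (w e)%:R) (finset.sub0set E).
rewrite cards0 expr0 mul1r setD0 => h.
apply: le_trans (le_trans h _).
  apply: rs_le => J _ hJ; rewrite finset.sub0set setD0 -natr_sum /= ler_wpM2l //; lra.
rewrite ler_expR.
apply: (le_trans (_ : _ <= - (a / 8 * ((1 + a) * p * W)) + p * ((a / 8 + a ^+ 2 / 16) * W))).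
  rewrite lerD2l ler_wpM2l //.
  apply: (le_trans (_ : _ <= (a / 8 + a ^+ 2 / 16) * (\sum_(e in E) w e)%:R)).
    rewrite natr_sum mulr_sumr; apply: ler_sum => e _.
    have := @expR_le_quad (a / 8 * (w e)%:R).
    move: (w2 e); case: (w e) => [|[|[|//]]] _.
    - by rewrite !mulr0 expR0; lra.
    - by move=> /(_ _ _)-/(_ ltac:(lra) ltac:(lra)); nra.
    - by move=> /(_ _ _)-/(_ ltac:(lra) ltac:(lra)); nra.
  by rewrite ler_wpM2l //; nra.
have := mulr_ge0 p0 W0; nra.
Qed.

End RandomSubset.

(** * Random graphs *)

Section DirectedCount.
Variable n : nat.
Implicit Types (D : {set 'I_n * 'I_n}) (G H : sgraph n).

(* Edges are counted through ordered pairs, so that an edge lying in [D] both ways counts twice. *)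
Definition dcount G D : nat := #|[set d in D | adj G d.1 d.2]|.

Definition mult D (e : {set 'I_n}) : nat := #|[set d in D | [set d.1; d.2] == e]|.

Lemma mult_le2 D e : (mult D e <= 2)%N.
Proof.
have [/eqP|] := boolP ([set d in D | [set d.1; d.2] == e] == set0).
  by rewrite /mult => ->; rewrite cards0.
case/set0Pn=> -[u v]; rewrite inE /= => /andP[_ /eqP E].
apply: leq_trans (_ : (#|[set (u, v); (v, u)]| <= 2)%N); last by rewrite cards2; case: eqP.
apply: subset_leq_card; apply/fintype.subsetP => -[a b]; rewrite !inE /= -E !xpair_eqE.
case/andP=> _ /eqP h.
have : a \in [set u; v] by rewrite -h set21.
have : b \in [set u; v] by rewrite -h set22.
have : u \in [set a; b] by rewrite h set21.
have : v \in [set a; b] by rewrite h set22.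
rewrite !inE => Hv Hu Hb Ha; case/orP: Ha Hu Hv => /eqP ->; case/orP: Hb => /eqP ->.
- by rewrite !orbb => _ /eqP ->; rewrite eqxx.
- by rewrite !eqxx.
- by rewrite !eqxx !orbT.
- by rewrite !orbb => /eqP ->; rewrite eqxx.
Qed.

Lemma dcountE G D : dcount G D = (\sum_(e in edges G) mult D e)%N.
Proof.
rewrite /dcount -sum1_card (partition_big (fun d => [set d.1; d.2]) (mem (edges G))) /=; last first.
  by move=> d; rewrite !inE => /andP[].
apply: eq_bigr => e eG; rewrite /mult -sum1_card; apply: eq_bigl => d.
rewrite !inE -andbA; congr (_ && _); rewrite /adj.
by case: eqP => [->|_]; rewrite ?andbF // andbT.
Qed.

Lemma sum_mult D : (\sum_(e in vpairs n) mult D e)%N = #|[set d in D | d.1 != d.2]|.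
Proof.
rewrite -[RHS]sum1_card (partition_big (fun d => [set d.1; d.2]) (mem (vpairs n))) /=; last first.
  by move=> d; rewrite !inE => /andP[_ h]; rewrite cards2 h.
apply: eq_bigr => e; rewrite inE => /eqP eG; rewrite /mult -sum1_card; apply: eq_bigl => d.
rewrite !inE -andbA; congr (_ && _).
case: eqP => [E|_]; rewrite ?andbF // andbT.
by move: eG; rewrite -E cards2; case: eqP.
Qed.

Lemma adj_sym G : symmetric (adj G).
Proof. by move=> u v; rewrite /adj finset.setUC. Qed.

Lemma adj_irr G : irreflexive (adj G).
Proof.
move=> u; apply/negP; rewrite /adj; case: G => E /= sE /(fintype.subsetP sE).
by rewrite inE finset.setUid cards1.
Qed.

Lemma adj_sub H G u v : subgraph H G -> adj H u v -> adj G u v.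
Proof. by move=> /fintype.subsetP; apply. Qed.

Lemma dcount_sub H G D : subgraph H G -> (dcount H D <= dcount G D)%N.
Proof.
move=> s; apply: subset_leq_card; apply/fintype.subsetP => d; rewrite !inE => /andP[->].
by move=> /(adj_sub s).
Qed.

Lemma dcount_del G H D : (dcount G D <= dcount (del G H) D + dcount H D)%N.
Proof.
apply: leq_trans (leq_card_setU _ _).1.
apply: subset_leq_card; apply/fintype.subsetP => d; rewrite !inE => /andP[-> /=].
by rewrite /adj inE => ->; rewrite andbT orNb.
Qed.

Lemma dcount_setX G (A B : {set 'I_n}) :
  dcount G (setX A B) = (\sum_(u in A) #|[set v | adj G u v] :&: B|)%N.
Proof.
rewrite /dcount -sum1_card (partition_big fst (mem A)) /=; last first.
  by move=> d; rewrite !inE => /andP[/andP[]].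
apply: eq_bigr => u uA; rewrite -sum1_card.
rewrite (reindex_onto (fun v => (u, v)) snd) /=; last first.
  by move=> [a b] /andP[_ /eqP /= ->].
apply: eq_bigl => v; rewrite !inE /= !eqxx uA /= !andbT.
by rewrite andbC.
Qed.

Lemma dcount_deg G (A : {set 'I_n}) : dcount G (setX A [set: 'I_n]) = (\sum_(u in A) deg G u)%N.
Proof. by rewrite dcount_setX; apply: eq_bigr => u _; rewrite finset.setIT. Qed.

End DirectedCount.

Lemma expRN2_le (R : realType) : expR (- 2) <= 1 / 4 :> R.
Proof.
have h1 : 2 <= expR 1 :> R by apply: le_trans (expR_ge1Dx 1); rewrite -natr1.
have E : expR 2 = expR 1 * expR 1 :> R by rewrite -expRD.
rewrite expRN E -[_^-1]div1r; move: (expR 1) h1 => x h1.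
by rewrite ler_pM2l // lef_pV2 ?posrE; nra.
Qed.

(** * Tail bounds for edge counts in the binomial random graph *)

Section Gnp.
Variables (R : realType) (n : nat) (p : R).
Hypothesis p01 : 0 <= p <= 1.
Implicit Types (A B : pred (sgraph n)).

Lemma gnp_rsE (A : pred {set {set 'I_n}}) :
  gnp_prob p (fun G : sgraph n => A (edges G)) = rs_prob (vpairs n) p A.
Proof.
have G0 : sgraph n by exists set0; apply: finset.sub0set.
rewrite /rs_prob (reindex_onto (@edges n) (insubd G0)) /=; last first.
  by move=> J /andP[sJ _]; rewrite -[edges _]/(val _) val_insubd sJ.
apply: eq_big => [G|G _] //.
by rewrite -[edges G]/(val G) valKd eqxx andbT (valP G).
Qed.

(** A graph event as an event on sets of pairs; the value [false] is only taken off the subsets of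
    [vpairs], which carry no mass. *)
Definition on_edges A (J : {set {set 'I_n}}) : bool := if insub J is Some G then A G else false.

Lemma gnpE A : gnp_prob p A = rs_prob (vpairs n) p (on_edges A).
Proof.
rewrite -gnp_rsE; apply: eq_bigl => G.
by rewrite /on_edges -[edges G]/(val G) valK.
Qed.

Lemma gnp_le A B : (forall G, A G -> B G) -> gnp_prob p A <= gnp_prob p B.
Proof.
move=> AB; rewrite !gnpE; apply: rs_le => // J _; rewrite /on_edges.
by case: insub => // G; apply: AB.
Qed.

Lemma gnp_union (I : finType) (A : I -> pred (sgraph n)) :
  gnp_prob p (fun G => [exists i, A i G]) <= \sum_i gnp_prob p (A i).
Proof.
under eq_bigr do rewrite gnpE; apply: le_trans (rs_union _ p01 _).
rewrite gnpE; apply: rs_le => // J _; rewrite /on_edges.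
by case: insub => // G.
Qed.

Lemma gnp_or A B : gnp_prob p (fun G => A G || B G) <= gnp_prob p A + gnp_prob p B.
Proof.
have := gnp_union (fun b : bool => if b then A else B).
rewrite big_bool /=; apply: le_trans; apply: gnp_le => G /orP[h|h]; apply/existsP.
  by exists true.
by exists false.
Qed.

Lemma gnp_compl A : gnp_prob p A = 1 - gnp_prob p (predC A).
Proof.
apply/eqP; rewrite eq_sym subr_eq -(rs_compl (vpairs n) p (on_edges A)) gnpE eq_sym; apply/eqP.
congr (_ + _); rewrite gnpE; apply: eq_bigl => J; rewrite /on_edges /=.
by case: insubP => [G -> _|/negPf ->].
Qed.

Lemma gnp_prob_ge0 A : 0 <= gnp_prob p A.
Proof. by rewrite gnpE; apply: rs_prob_ge0. Qed.

Implicit Types (D : {set 'I_n * 'I_n}) (F : sgraph n).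

(** The pairs of [D] avoid [F], so the event [F] inside [G] is independent of the count and
    contributes the factor [p ^+ #|edges F|]. *)
Lemma gnp_lower (a : R) D F : 0 <= a <= 1 ->
  (forall d, d \in D -> d.1 != d.2) -> (forall d, d \in D -> ~~ adj F d.1 d.2) ->
  gnp_prob p (fun G => subgraph F G && ((dcount G D)%:R <= (1 - a) * p * #|D|%:R)) <=
  p ^+ #|edges F| * expR (- (a ^+ 2 / 8) * p * #|D|%:R).
Proof.
move=> a01 irr dis.
have WE : (\sum_(e in vpairs n) mult D e)%N = #|D|.
  by rewrite sum_mult; apply: eq_card => d; rewrite inE; case: (boolP (d \in D)) => // /irr.
have FV : edges F \subset vpairs n by case: F {dis}.
have := rs_lower p01 FV (mult_le2 D) _ a01; rewrite WE => h.
apply: le_trans (h _); last first.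
  move=> e eF; apply/eqP; rewrite /mult cards_eq0; apply/eqP/setP => d; rewrite !inE.
  apply/negP => /andP[/dis /negP dD /eqP E]; apply: dD; by rewrite /adj E.
rewrite -gnp_rsE; apply: gnp_le => G.
by rewrite dcountE.
Qed.

Lemma gnp_upper (a : R) D : 0 <= a <= 1 ->
  gnp_prob p (fun G => (1 + a) * p * #|D|%:R <= (dcount G D)%:R) <=
  expR (- (a ^+ 2 / 16) * p * #|D|%:R).
Proof.
move=> a01; have WE : (\sum_(e in vpairs n) mult D e)%:R <= #|D|%:R :> R.
  by rewrite sum_mult ler_nat; apply: subset_leq_card; apply/fintype.subsetP => d; rewrite inE => /andP[].
apply: le_trans (rs_upper p01 (mult_le2 D) WE a01).
by rewrite -gnp_rsE; apply: gnp_le => G; rewrite dcountE.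
Qed.

(** For counts far above their mean, where [s] has to be large; [expR (2 * s)] allows for pairs of
    weight two. *)
Lemma gnp_upper_exp (s k : R) D : 0 <= s ->
  gnp_prob p (fun G => k <= (dcount G D)%:R) <=
  expR (- (s * k) + p * (expR (2 * s) * #|D|%:R)).
Proof.
move=> s0; have p0 : 0 <= p by case/andP: p01.
have := rs_tail p01 s k (fun e => (mult D e)%:R) (finset.sub0set (vpairs n)).
rewrite cards0 expr0 mul1r finset.setD0 => h; apply: le_trans (le_trans h _).
  rewrite -gnp_rsE; apply: gnp_le => G hk.
  by rewrite finset.sub0set finset.setD0 -natr_sum -dcountE /= ler_wpM2l.
rewrite ler_expR lerD2l ler_wpM2l //.
apply: (le_trans (_ : _ <= expR (2 * s) * (\sum_(e in vpairs n) mult D e)%:R)); last first.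
  rewrite ler_wpM2l ?expR_ge0 // sum_mult ler_nat; apply: subset_leq_card.
  by apply/fintype.subsetP => d; rewrite inE => /andP[].
rewrite natr_sum mulr_sumr; apply: ler_sum => e _.
have e1 : 1 <= expR (2 * s) by have := expR_ge1Dx (2 * s); lra.
have e2 : expR s <= expR (2 * s) by rewrite ler_expR; lra.
move: (mult_le2 D e); case: (mult D e) => [|[|[|//]]] _; rewrite ?mulr0 ?expR0 ?subrr //.
  by rewrite !mulr1; lra.
by rewrite [s * _]mulrC; lra.
Qed.

Lemma gnp_few_edges (k : R) F (W : {set {set 'I_n}}) : W \subset vpairs n :\: edges F ->
  gnp_prob p (fun G => subgraph F G && ((#|edges G :&: W|)%:R <= k)) <=
  p ^+ #|edges F| * expR (2 * k - 3 / 4 * p * #|W|%:R).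
Proof.
move=> sW; have p0 : 0 <= p by case/andP: p01.
have FV : edges F \subset vpairs n by case: F {sW}.
have ind (J : {set {set 'I_n}}) : (\sum_(e in J :\: edges F) (e \in W)%:R : R) = #|J :&: W|%:R.
  rewrite -natr_sum -sum1_card [in RHS]big_mkcond [in LHS]big_mkcond /=; congr _%:R.
  apply: eq_bigr => e _; rewrite !inE; case: (boolP (e \in W)) => eW; last by rewrite andbF; case: ifP.
  by move/fintype.subsetP: sW => /(_ _ eW); rewrite inE => /andP[-> _]; rewrite andbT.
have := rs_tail p01 (- 2) k (fun e => (e \in W)%:R) FV; move=> h; apply: le_trans (le_trans h _).
  rewrite -gnp_rsE; apply: gnp_le => G /andP[FG hk].
  by apply/andP; split=> //; rewrite ind !mulNr lerN2 ler_wpM2l.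
rewrite ler_wpM2l ?exprn_ge0 // ler_expR mulNr opprK lerD2l.
have e2 := expRN2_le R; clear h.
apply: (le_trans (_ : _ <= p * (- (3 / 4) * #|W|%:R))); last by lra.
rewrite ler_wpM2l //.
have -> : #|W|%:R = \sum_(e in vpairs n :\: edges F) (e \in W)%:R :> R.
  rewrite ind; congr _%:R; apply: eq_card => e; rewrite inE.
  case: (boolP (e \in W)) => eW; rewrite ?andbF // andbT.
  by move/fintype.subsetP: sW => /(_ _ eW); rewrite inE => /andP[_ ->].
rewrite mulr_sumr; apply: ler_sum => e _; case: (e \in W); rewrite ?mulr0 ?expR0 ?mulr1 ?subrr //.
by move: (expR _) e2 => x e2; lra.
Qed.

End Gnp.

(** * Typical properties *)

Section Typical.
Variables (R : realType) (n : nat) (p : R).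
Hypothesis p01 : 0 <= p <= 1.
Hypothesis n_gt1 : (1 < n)%N.
Let x := n%:R * p.
Implicit Types (G F : sgraph n) (A B : {set 'I_n}).

Let p_ge0 : 0 <= p. Proof. by case/andP: p01. Qed.
Let nR_gt0 : 0 < n%:R :> R. Proof. by rewrite ltr0n; apply: ltnW. Qed.
Let x_ge0 : 0 <= x. Proof. by rewrite mulr_ge0 ?ler0n. Qed.

Lemma gnp_union_le (I : finType) (A : I -> pred (sgraph n)) (b : R) :
  (forall i, gnp_prob p (A i) <= b) ->
  gnp_prob p (fun G => [exists i, A i G]) <= #|I|%:R * b.
Proof.
move=> h; apply: le_trans (gnp_union p01 A) _.
by rewrite mulr_natl -sumr_const; apply: ler_sum => i _.
Qed.

Lemma exp2_le_expR k : (2 ^ k)%:R <= expR k%:R :> R.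
Proof.
rewrite natrX -[k%:R in leRHS]mulr1 expRM_natl.
by apply: lerXn2r; rewrite ?nnegrE ?expR_ge0 //; have := @expR_ge1Dx R 1; rewrite -natr1.
Qed.

(** The diagonal is removed because [gnp_lower] asks for pairs of distinct vertices. *)
Definition offdiag A B : {set 'I_n * 'I_n} := [set d in setX A B | d.1 != d.2].

Lemma card_offdiag A B : #|A|%:R * (#|B|%:R - 1) <= #|offdiag A B|%:R :> R.
Proof.
rewrite mulrBr mulr1 lerBlDr -natrM -natrD ler_nat -cardsX.
rewrite -(card_imset A (f := fun u => (u, u))); last by move=> u v [].
apply: leq_trans (leq_card_setU _ _).1.
apply: subset_leq_card; apply/fintype.subsetP => -[u v]; rewrite !inE /= => /andP[uA vB].
rewrite uA vB /=; case: eqP => //= uv; by apply/imsetP; exists u; rewrite // uv.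
Qed.

(** There are [4^n <= expR (2n)] pairs of sets, and each fails with probability at most
    [expR (- 3n)], as [offdiag] has at least [d^2 n^2 / 2] elements. *)
Lemma gnp_pairs_dense (a d : R) : 0 <= a <= 1 -> 0 < d -> 2 <= d * n%:R ->
  3 <= a ^+ 2 * d ^+ 2 / 16 * x ->
  gnp_prob p (fun G => [exists AB : {set 'I_n} * {set 'I_n},
    [&& d * n%:R <= #|AB.1|%:R, d * n%:R <= #|AB.2|%:R &
        (dcount G (offdiag AB.1 AB.2))%:R <= (1 - a) * p * #|offdiag AB.1 AB.2|%:R]])
  <= expR (- n%:R).
Proof.
move=> a01 d0 dn hx.
apply: le_trans (gnp_union_le (b := expR (- (a ^+ 2 / 16 * d ^+ 2 * x * n%:R))) _) _.
  move=> [A B] /=; case: (boolP (d * n%:R <= #|A|%:R)) => hA /=; last first.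
    by apply: le_trans (expR_ge0 _); rewrite /gnp_prob big1.
  case: (boolP (d * n%:R <= #|B|%:R)) => hB /=; last first.
    by apply: le_trans (expR_ge0 _); rewrite /gnp_prob big1.
  (* [gnp_lower] is applied with the empty graph in the role of [F]. *)
  pose E0 : sgraph n := SGraph (finset.sub0set (vpairs n)).
  have := gnp_lower p01 (F := E0) (D := offdiag A B) a01.
  have irr d' : d' \in offdiag A B -> d'.1 != d'.2 by rewrite inE => /andP[].
  have avoid d' : d' \in offdiag A B -> ~~ adj E0 d'.1 d'.2 by move=> _; rewrite /adj /= inE.
  move=> /(_ irr avoid) h.
  have -> : (fun G => (dcount G (offdiag A B))%:R <= (1 - a) * p * #|offdiag A B|%:R) =
     (fun G => subgraph E0 G && ((dcount G (offdiag A B))%:R <= (1 - a) * p * #|offdiag A B|%:R)).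
    by apply/funext => G; rewrite /subgraph finset.sub0set.
  apply: le_trans h _; rewrite cards0 expr0 mul1r ler_expR.
  have c1 := card_offdiag A B.
  have c2 : d ^+ 2 / 2 * n%:R ^+ 2 <= #|offdiag A B|%:R.
    apply: le_trans c1; apply: (le_trans (_ : _ <= d * n%:R * (d * n%:R - 1))); first by nra.
    by apply: ler_pM => //; lra.
  have := mulr_ge0 (mulr_ge0 (sqr_ge0 a) p_ge0) (_ : 0 <= #|offdiag A B|%:R - d ^+ 2 / 2 * n%:R ^+ 2).
  rewrite subr_ge0 => /(_ c2); rewrite /x; lra.
have -> : #|{: {set 'I_n} * {set 'I_n}}| = (2 ^ (n + n))%N.
  by rewrite card_prod -!cardsT -powersetT card_powerset cardsT card_ord expnD.
apply: (le_trans (ler_wpM2r (expR_ge0 _) (exp2_le_expR _))).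
rewrite -expRD ler_expR natrD.
have := ler_wpM2r (ltW nR_gt0) hx; lra.
Qed.

Lemma gnp_degree_sum (a d : R) : 0 <= a <= 1 -> 0 < d -> 2 <= a ^+ 2 * d / 16 * x ->
  gnp_prob p (fun G => [exists A : {set 'I_n}, (d * n%:R <= #|A|%:R) &&
    ((1 + a) * p * #|setX A [set: 'I_n]|%:R <= (dcount G (setX A [set: 'I_n]))%:R)])
  <= expR (- n%:R).
Proof.
move=> a01 d0 hx.
apply: le_trans (gnp_union_le (b := expR (- (a ^+ 2 / 16 * d * x * n%:R))) _) _.
  move=> A /=; case: (boolP (d * n%:R <= #|A|%:R)) => hA /=; last first.
    by apply: le_trans (expR_ge0 _); rewrite /gnp_prob big1.
  apply: le_trans (gnp_upper p01 _ a01) _; rewrite ler_expR cardsX cardsT card_ord natrM.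
  have := mulr_ge0 (mulr_ge0 (mulr_ge0 (sqr_ge0 a) p_ge0) (ltW nR_gt0)) (_ : 0 <= #|A|%:R - d * n%:R).
  rewrite subr_ge0 => /(_ hA); rewrite /x; lra.
have -> : #|{: {set 'I_n}}| = (2 ^ n)%N.
  by rewrite -!cardsT -powersetT card_powerset cardsT card_ord.
apply: (le_trans (ler_wpM2r (expR_ge0 _) (exp2_le_expR _))).
rewrite -expRD ler_expR.
have := ler_wpM2r (ltW nR_gt0) hx; lra.
Qed.

Hypothesis n_le_expR : n%:R <= expR x.

(** With [s = 4 / eta] the exponent for a set of size [k <= d n] is at most [- 4xk + 2xk]. Each set
    thus fails with probability at most [c^k], where [c = expR (- 2x) <= n^(-2)], and summing over
    non-empty sets gives [(1 + c)^n - 1]. *)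
Lemma gnp_small_sets (eta d : R) : 0 < eta -> 0 < d -> d * expR (8 / eta) <= 2 ->
  gnp_prob p (fun G => [exists A : {set 'I_n}, [&& A != set0, #|A|%:R <= d * n%:R &
     eta * x * #|A|%:R <= (dcount G (setX A A))%:R]]) <= 3 / n%:R.
Proof.
move=> eta0 d0 hd.
pose c : R := expR (- (2 * x)).
have c0 : 0 <= c by apply: expR_ge0.
have cn : c <= n%:R^-1 ^+ 2.
  rewrite /c mulr_natl mulr2n opprD expRD expRN expr2.
  have : (expR x)^-1 <= n%:R^-1 by rewrite lef_pV2 ?posrE ?expR_gt0.
  by move=> h; apply: ler_pM; rewrite ?invr_ge0 ?expR_ge0.
have each A : gnp_prob p (fun G => [&& A != set0, #|A|%:R <= d * n%:R &
     eta * x * #|A|%:R <= (dcount G (setX A A))%:R]) <= (A != set0)%:R * c ^+ #|A|.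
  case: (boolP (A != set0)) => A0; last by rewrite mul0r /gnp_prob big1.
  rewrite mul1r; case: (boolP (#|A|%:R <= d * n%:R)) => hA /=; last first.
    by rewrite /gnp_prob big1 // exprn_ge0.
  have s0 : 0 <= 4 / eta by rewrite divr_ge0 // ltW.
  apply: le_trans (gnp_upper_exp p01 _ _ s0) _.
  rewrite /c -expRM_natl ler_expR cardsX natrM.
  have -> : 4 / eta * (eta * x * #|A|%:R) = 4 * x * #|A|%:R by field; apply: lt0r_neq0.
  have -> : 2 * (4 / eta) = 8 / eta by lra.
  move: (expR _) (expR_ge0 (8 / eta)) hd => y y0 hd.
  have a0 : 0 <= #|A|%:R :> R by [].
  have h1 : p * (y * (#|A|%:R * #|A|%:R)) <= p * (y * (#|A|%:R * (d * n%:R))).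
    by rewrite !ler_wpM2l.
  have h2 : x * #|A|%:R * (d * y) <= x * #|A|%:R * 2.
    by rewrite ler_wpM2l // mulr_ge0.
  by rewrite /x in h2 *; rewrite mulr_natl; lra.
apply: le_trans (gnp_union p01 _) _.
apply: le_trans (ler_sum _ (fun A _ => each A)) _.
have S : \sum_(A : {set 'I_n}) c ^+ #|A| = (1 + c) ^+ n.
  rewrite -[in RHS](card_ord n) -prodr_const.
  rewrite (eq_bigr (fun _ : 'I_n => c + 1)); last by move=> *; rewrite addrC.
  rewrite bigA_distr; apply: eq_bigr => A _; rewrite -prodr_const big_mkcond /=.
  by apply: eq_bigr.
have -> : \sum_(A : {set 'I_n}) (A != set0)%:R * c ^+ #|A| = (1 + c) ^+ n - 1.
  rewrite -S (bigD1 set0) //= eqxx mul0r add0r [in RHS](bigD1 set0) //= cards0 expr0.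
  rewrite addrAC subrr add0r; apply: eq_bigr => A h; by rewrite h mul1r.
have h1 : (1 + c) ^+ n <= expR (n%:R^-1).
  apply: (le_trans (_ : _ <= expR c ^+ n)).
    by apply: lerXn2r; rewrite ?nnegrE ?addr_ge0 ?expR_ge0 ?expR_ge1Dx.
  rewrite -expRM_natl ler_expR; apply: le_trans (ler_wpM2l (ltW nR_gt0) cn) _.
  by rewrite expr2 mulrA divff ?mul1r // lt0r_neq0.
have n1 : n%:R^-1 <= 2^-1 :> R by rewrite lef_pV2 ?posrE // ler_nat.
have i0 : 0 <= n%:R^-1 :> R by rewrite invr_ge0 ltW.
have := expR_le_quad i0 n1; move: (expR _) h1 => y h1 h2; nra.
Qed.

End Typical.

(** * Low vertices are scattered *)

Section LowDegree.
Variables (R : realType) (n : nat) (p : R).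
Hypothesis p01 : 0 <= p <= 1.
Let x := n%:R * p.
Hypothesis n_le_expR : n%:R <= expR x.
Hypothesis x_ge1 : 1 <= x.
Implicit Types (G : sgraph n).
Notation V := 'I_n.

Let p_ge0 : 0 <= p. Proof. by case/andP: p01. Qed.

Definition low G : {set V} := low_deg (x / 100) G.

(** Low degrees in [Y] leave few edges among the pairs from [Y] to the outside of [Z]. These pairs
    are distinct and avoid [F], so the two requirements are independent. *)
Lemma gnp_low_config (F : {set {set V}}) (Y Z : {set V}) :
  F \subset vpairs n -> (forall e, e \in F -> e \subset Z) -> Y \subset Z -> (#|Z| <= 5)%N ->
  gnp_prob p (fun G => (F \subset edges G) && (Y \subset low G)) <=
  p ^+ #|F| * expR (#|Y|%:R * (15 / 4 - 73 / 100 * x)).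
Proof.
move=> FV FZ YZ Z5.
pose D : {set V * V} := setX Y (~: Z).
pose W : {set {set V}} := [set [set d.1; d.2] | d in D].
have cW : #|W| = (#|Y| * #|~: Z|)%N.
  rewrite card_in_imset ?cardsX // => -[y z] [y' z']; rewrite !inE /= => /andP[yY zZ] /andP[yY' zZ'] E.
  have yZ := fintype.subsetP YZ _ yY; have yZ' := fintype.subsetP YZ _ yY'.
  have : y \in [set y'; z'] by rewrite -E set21.
  rewrite !inE => /orP[/eqP Ey|/eqP Ey]; last by move: zZ'; rewrite -Ey yZ.
  have : z \in [set y'; z'] by rewrite -E set22.
  by rewrite !inE => /orP[/eqP Ez|/eqP ->]; [move: zZ; rewrite Ez yZ'|rewrite Ey].
have WV : W \subset vpairs n :\: F.
  apply/fintype.subsetP => e /imsetP[[y z]]; rewrite !inE /= => /andP[yY zZ] ->.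
  apply/andP; split.
    by apply: contra zZ => /FZ/fintype.subsetP; apply; rewrite set22.
  have -> : #|[set y; z]| = 2%N; last by [].
  by rewrite cards2 (contraNneq _ zZ) // => <-; apply: (fintype.subsetP YZ).
have few G : Y \subset low G -> #|edges G :&: W|%:R <= #|Y|%:R * (x / 100).
  move=> /fintype.subsetP lY; apply: (le_trans (_ : _ <= (dcount G (setX Y [set: V]))%:R)).
    rewrite ler_nat /dcount.
    apply: leq_trans (leq_imset_card (fun d => [set d.1; d.2]) _).
    apply: subset_leq_card; apply/fintype.subsetP => e; rewrite inE => /andP[eG /imsetP[d dD E]].
    apply/imsetP; exists d => //; rewrite !inE /adj -E eG andbT.
    by move: dD; rewrite inE => /andP[->].
  rewrite dcount_deg natr_sum mulr_natl -sumr_const; apply: ler_sum => y /lY.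
  by rewrite inE => /ltW.
have := gnp_few_edges p01 (#|Y|%:R * (x / 100)) (F := SGraph FV) WV => h.
apply: le_trans (le_trans h _); first by apply: gnp_le => // G /andP[FG /few lG]; apply/andP.
rewrite ler_wpM2l ?exprn_ge0 // ler_expR cW natrM; clear h few cW WV.
have cZ : n%:R - 5 <= #|~: Z|%:R :> R.
  have cC : #|Z|%:R + #|~: Z|%:R = n%:R :> R by rewrite -natrD cardsC card_ord.
  by move: Z5 cC; rewrite -(ler_nat R); lra.
have y0 : 0 <= #|Y|%:R :> R by [].
(* Here [73/100 = 3/4 - 2/100], and [15/4 = 5 * 3/4] pays for the at most five vertices of [Z],
   using [p <= 1]. *)
have := mulr_ge0 (mulr_ge0 p_ge0 y0) (_ : 0 <= #|~: Z|%:R - (n%:R - 5)); rewrite subr_ge0 => /(_ cZ).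
have : p * #|Y|%:R <= #|Y|%:R by rewrite ler_piMl //; case/andP: p01.
by rewrite /x; lra.
Qed.

Lemma set2_eq (a b c d : V) :
  ([set a; b] == [set c; d]) = ((a == c) && (b == d)) || ((a == d) && (b == c)).
Proof.
apply/eqP/idP => [E|/orP[/andP[/eqP -> /eqP ->] //|/andP[/eqP -> /eqP ->]]]; last exact: finset.setUC.
have : a \in [set c; d] by rewrite -E set21.
have : b \in [set c; d] by rewrite -E set22.
have : c \in [set a; b] by rewrite E set21.
have : d \in [set a; b] by rewrite E set22.
rewrite !inE => Hd Hc Hb Ha; case/orP: Ha Hc Hd => /eqP ->; case/orP: Hb => /eqP ->.
- by rewrite !orbb => _ /eqP ->; rewrite eqxx.
- by rewrite !eqxx.
- by rewrite !eqxx !orbT.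
- by rewrite !orbb => /eqP ->; rewrite eqxx.
Qed.

Lemma gnp_low_seq (vs ys : seq V) (es : seq (V * V)) :
  (size vs <= 5)%N -> uniq ys -> all [in vs] ys ->
  all (fun e => [&& e.1 != e.2, e.1 \in vs & e.2 \in vs]) es ->
  uniq [seq [set e.1; e.2] | e <- es] ->
  gnp_prob p (fun G => all (fun e => adj G e.1 e.2) es && all [in low G] ys) <=
  p ^+ size es * expR ((size ys)%:R * (15 / 4 - 73 / 100 * x)).
Proof.
move=> s5 uy yv /allP ev ue.
pose F : {set {set V}} := [set e in [seq [set e.1; e.2] | e <- es]].
pose Y : {set V} := [set y in ys]; pose Z : {set V} := [set v in vs].
have cF : #|F| = size es by rewrite cardsE (card_uniqP ue) size_map.
have cY : #|Y| = size ys by rewrite cardsE (card_uniqP uy).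
rewrite -cF -cY; apply: le_trans (gnp_low_config (Z := Z) _ _ _ _).
- apply: gnp_le => // G /andP[/allP h1 /allP h2]; apply/andP; split.
    by apply/fintype.subsetP => e; rewrite inE => /mapP[d /h1 dG ->].
  by apply/fintype.subsetP => y; rewrite inE => /h2.
- by apply/fintype.subsetP => e; rewrite !inE => /mapP[d /ev /and3P[dd _ _] ->]; rewrite cards2 dd.
- move=> e; rewrite inE => /mapP[d /ev /and3P[_ d1 d2] ->].
  by apply/fintype.subsetP => v; rewrite !inE => /orP[]/eqP ->.
- by apply/fintype.subsetP => y; rewrite !inE => /(allP yv).
- by apply: leq_trans s5; rewrite cardsE; apply: card_size.
Qed.

(** The forbidden configurations: two low vertices joined by a path of length one ([clash_edge]),
    two ([clash_cherry]) or four ([clash_path]), and a low vertex on a 4-cycle ([clash_cycle]).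
    Without cherries the low neighbour of a vertex is unique; without the other three, a high vertex
    has at most one neighbour with a further low neighbour. *)
Definition clash_edge G := [exists t : V * V,
  [&& uniq [:: t.1; t.2], adj G t.1 t.2 & (t.1 \in low G) && (t.2 \in low G)]].

Definition clash_cherry G := [exists t : V * V * V, let: (v, y, z) := t in
  [&& uniq [:: v; y; z], adj G v y, adj G v z & (y \in low G) && (z \in low G)]].

Definition clash_cycle G := [exists t : V * V * V * V, let: (u, y, v, w) := t in
  [&& uniq [:: u; y; v; w], [&& adj G u v, adj G u w, adj G y v & adj G y w] & y \in low G]].

Definition clash_path G := [exists t : V * V * V * V * V, let: (u, v, w, y, z) := t in
  [&& uniq [:: u; v; w; y; z], [&& adj G u v, adj G u w, adj G v y & adj G w z] &
      (y \in low G) && (z \in low G)]].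

Let E k : R := expR (k%:R * (15 / 4 - 73 / 100 * x)).

Lemma gnp_le0 (A : pred (sgraph n)) (b : R) : (forall G, ~~ A G) -> 0 <= b -> gnp_prob p A <= b.
Proof. by move=> h; rewrite /gnp_prob big1 // => G; rewrite (negPf (h G)). Qed.

Lemma pE_ge0 m k : 0 <= p ^+ m * E k.
Proof. by rewrite mulr_ge0 ?exprn_ge0 ?expR_ge0. Qed.

Ltac distinct := rewrite /= ?inE ?set2_eq ?eqxx ?orbT ?andbT ?andbF ?orbF //=;
  repeat (case: eqP => [?|_]; first by subst; match goal with
    H : is_true (?a != ?a) |- _ => rewrite eqxx in H end); rewrite /= ?andbF ?orbF //.

Lemma gnp_clash_edge : gnp_prob p clash_edge <= n%:R ^+ 2 * (p ^+ 1 * E 2).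
Proof.
rewrite (_ : n%:R ^+ 2 = #|{: V * V}|%:R); last by rewrite card_prod card_ord natrM.
apply: gnp_union_le => // -[y z].
have [|U] := boolP (uniq [:: y; z]); last first.
  by apply: gnp_le0 => [G|]; [apply: contra U => /andP[]|exact: pE_ge0].
rewrite /= !inE andbT => yz.
apply: le_trans (@gnp_low_seq [:: y; z] [:: y; z] [:: (y, z)] _ _ _ _ _) => //; try by distinct.
by apply: gnp_le => // G /= /andP[-> /andP[-> ->]].
Qed.

Lemma gnp_clash_cherry : gnp_prob p clash_cherry <= n%:R ^+ 3 * (p ^+ 2 * E 2).
Proof.
rewrite (_ : n%:R ^+ 3 = #|{: V * V * V}|%:R); last by rewrite !card_prod card_ord -natrX !expnS expn0 muln1 -!mulnA.
apply: gnp_union_le => // -[[v y] z].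
have [|U] := boolP (uniq [:: v; y; z]); last first.
  by apply: gnp_le0 => [G|]; [apply: contra U => /andP[]|exact: pE_ge0].
rewrite /= !inE !negb_or andbT => /andP[/andP[vy vz] yz].
apply: le_trans (@gnp_low_seq [:: v; y; z] [:: y; z] [:: (v, y); (v, z)] _ _ _ _ _) => //; try by distinct.
by apply: gnp_le => // G /= /and3P[-> -> /andP[-> ->]].
Qed.

Lemma gnp_clash_cycle : gnp_prob p clash_cycle <= n%:R ^+ 4 * (p ^+ 4 * E 1).
Proof.
rewrite (_ : n%:R ^+ 4 = #|{: V * V * V * V}|%:R); last by rewrite !card_prod card_ord -natrX !expnS expn0 muln1 -!mulnA.
apply: gnp_union_le => // -[[[u y] v] w].
have [|U] := boolP (uniq [:: u; y; v; w]); last first.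
  by apply: gnp_le0 => [G|]; [apply: contra U => /andP[]|exact: pE_ge0].
rewrite /= !inE !negb_or andbT => /and3P[/and3P[uy uv uw] /andP[yv yw] vw].
apply: le_trans (@gnp_low_seq [:: u; y; v; w] [:: y] [:: (u, v); (u, w); (y, v); (y, w)] _ _ _ _ _) => //;
  try by distinct.
by apply: gnp_le => // G /= /andP[/and4P[-> -> -> ->] ->].
Qed.

Lemma gnp_clash_path : gnp_prob p clash_path <= n%:R ^+ 5 * (p ^+ 4 * E 2).
Proof.
rewrite (_ : n%:R ^+ 5 = #|{: V * V * V * V * V}|%:R); last by rewrite !card_prod card_ord -natrX !expnS expn0 muln1 -!mulnA.
apply: gnp_union_le => // -[[[[u v] w] y] z].
have [|U] := boolP (uniq [:: u; v; w; y; z]); last first.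
  by apply: gnp_le0 => [G|]; [apply: contra U => /andP[]|exact: pE_ge0].
rewrite /= !inE !negb_or andbT => /and4P[/and4P[uv uw uy uz] /and3P[vw vy vz] /andP[wy wz] yz].
apply: le_trans (@gnp_low_seq [:: u; v; w; y; z] [:: y; z] [:: (u, v); (u, w); (v, y); (w, z)] _ _ _ _ _) => //;
  try by distinct.
by apply: gnp_le => // G /= /andP[/and4P[-> -> -> ->] /andP[-> ->]].
Qed.

(** The fifth power of [x/11 <= expR (x/11)], together with [5/11 <= 46/100]. *)
Lemma exp_decay : x ^+ 4 * expR (- (46 / 100) * x) <= 11 ^+ 5 / x.
Proof.
have x0 : 0 < x := lt_le_trans ltr01 x_ge1.
rewrite ler_pdivlMr // mulrAC -exprSr.
have h : x / 11 <= expR (x / 11) by have := expR_ge1Dx (x / 11); move: (expR _) => y; lra.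
have h5 : (x / 11) ^+ 5 <= expR (x / 11) ^+ 5.
  by apply: lerXn2r; rewrite ?nnegrE ?expR_ge0 ?divr_ge0 // ltW.
rewrite -expRM_natl in h5.
have h6 : expR (5 * (x / 11)) * expR (- (46 / 100) * x) <= 1.
  by rewrite -expRD -[leRHS]expR0 ler_expR; lra.
have h7 : x ^+ 5 <= 11 ^+ 5 * expR (5 * (x / 11)).
  by move: h5; rewrite expr_div_n ler_pdivrMr ?exprn_gt0 // mulrC.
apply: le_trans (ler_wpM2r (expR_ge0 _) h7) _.
by rewrite -mulrA ler_piMr // exprn_ge0.
Qed.

(** A path with [k] edges has [k + 1] vertices, so the union bound gives [x^k] times [n * E 2];
    since [n <= expR x], the rate 146/100 of [E 2] drops to 46/100. The 4-cycle has as many edges as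
    vertices, so one low vertex suffices. *)
Lemma gnp_clash : gnp_prob p (fun G => [|| clash_edge G, clash_cherry G, clash_cycle G | clash_path G]) <=
  4 * expR (15 / 2) * 11 ^+ 5 / x.
Proof.
have x0 : 0 < x := lt_le_trans ltr01 x_ge1.
have tot : gnp_prob p (fun G => [|| clash_edge G, clash_cherry G, clash_cycle G | clash_path G]) <=
    gnp_prob p clash_edge + (gnp_prob p clash_cherry + (gnp_prob p clash_cycle + gnp_prob p clash_path)).
  apply: le_trans (gnp_or p01 _ _) _; rewrite lerD2l.
  by apply: le_trans (gnp_or p01 _ _) _; rewrite lerD2l; apply: gnp_or.
apply: (le_trans tot).
pose q : R := expR (15 / 2) * (x ^+ 4 * expR (- (46 / 100) * x)).
have xpow k : (k <= 4)%N -> x ^+ k <= x ^+ 4 by move=> k4; apply: ler_weXn2l.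
have E2 : n%:R * E 2 <= expR (15 / 2) * expR (- (46 / 100) * x).
  apply: le_trans (ler_wpM2r (expR_ge0 _) n_le_expR) _.
  by rewrite /E -!expRD ler_expR; lra.
have E1 : E 1 <= expR (15 / 2) * expR (- (46 / 100) * x).
  by rewrite /E -!expRD ler_expR; lra.
have nE2 k : (k <= 4)%N -> n%:R ^+ k.+1 * (p ^+ k * E 2) <= q.
  move=> /xpow k4; rewrite mulrA exprS -!mulrA [_ ^+ k * _]mulrA -exprMn -/x /q [n%:R * _]mulrCA.
  rewrite [expR (15 / 2) * _]mulrCA; apply: ler_pM => //; first by rewrite exprn_ge0 // ltW.
  by rewrite mulr_ge0 // expR_ge0.
have h1 := le_trans gnp_clash_edge (nE2 1%N isT).
have h2 := le_trans gnp_clash_cherry (nE2 2%N isT).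
have h3 : gnp_prob p clash_cycle <= q.
  apply: le_trans gnp_clash_cycle _; rewrite mulrA -exprMn -/x /q mulrCA.
  by apply: ler_pM => //; [rewrite exprn_ge0 // ltW|apply: expR_ge0].
have h4 := le_trans gnp_clash_path (nE2 4%N isT).
have hq : q <= expR (15 / 2) * (11 ^+ 5 / x) by rewrite ler_wpM2l ?expR_ge0 ?exp_decay.
rewrite -[_ * _ / x]mulrA -[4 * _ * _]mulrA; move: hq h1 h2 h3 h4; clear E1 E2 nE2 tot; move: q => q; move: (expR _ * (_ / _)) => z; lra.
Qed.

End LowDegree.

(** * A union bound over sparse graphs *)

Section Boosters.
Variables (R : realType) (n : nat) (p : R).
Hypothesis p01 : 0 <= p <= 1.
Let x := n%:R * p.
Notation V := 'I_n.

Let p_ge0 : 0 <= p. Proof. by case/andP: p01. Qed.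
Let x_ge0 : 0 <= x. Proof. by rewrite mulr_ge0. Qed.

Lemma sum_sgraph (h : {set {set V}} -> R) :
  \sum_(F : sgraph n) h (edges F) = \sum_(J : {set {set V}} | J \subset vpairs n) h J.
Proof.
have G0 : sgraph n by exists set0; apply: finset.sub0set.
rewrite [RHS](reindex_onto (@edges n) (insubd G0)) /=; last first.
  by move=> J sJ; rewrite -[edges _]/(val _) val_insubd sJ.
by apply: eq_bigl => F; rewrite -[edges F]/(val F) valKd eqxx andbT (valP F).
Qed.

Lemma card_vpairs : (#|vpairs n| <= n ^ 2)%N.
Proof.
have -> : #|vpairs n| = 'C(n, 2) by rewrite /vpairs card_draws card_ord.
by rewrite bin2 -divn2; apply: leq_trans (leq_div _ _) _; rewrite -mulnn leq_mul2l leq_pred orbT.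
Qed.

(* The number of graphs [F] is beaten by weighting each with [expR (lam * (m - #|F|))],
   [m] being the bound on [#|F|]: the weighted sum of the [p ^+ #|F|] factorises over pairs. *)
Lemma gnp_boosters (D : sgraph n -> {set V * V}) (a c lam mu : R) :
  0 <= a <= 1 -> 0 < c -> 0 <= lam -> expR (- lam) <= a ^+ 2 * c / 32 ->
  lam * mu <= a ^+ 2 * c / 32 -> 1 <= a ^+ 2 * c / 16 * x ->
  gnp_prob p (fun G => [exists F : sgraph n,
    [&& #|edges F|%:R <= mu * x * n%:R, c * n%:R ^+ 2 <= #|D F|%:R,
        [forall d in D F, (d.1 != d.2) && ~~ adj F d.1 d.2],
        subgraph F G & (dcount G (D F))%:R <= (1 - a) * p * #|D F|%:R]]) <= expR (- n%:R).
Proof.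
move=> a01 c0 lam0 hlam hmu hx.
set y := expR (- lam) in hlam *.
have y0 : 0 <= y by apply: expR_ge0.
pose b := expR (lam * (mu * x * n%:R) - a ^+ 2 / 8 * c * x * n%:R).
apply: le_trans (gnp_union p01 _) _.
apply: (le_trans (_ : _ <= \sum_(F : sgraph n) b * (p * y) ^+ #|edges F|)).
  apply: ler_sum => F _.
  have nn : 0 <= b * (p * y) ^+ #|edges F| by rewrite mulr_ge0 ?expR_ge0 ?exprn_ge0 ?mulr_ge0.
  case: (boolP (#|edges F|%:R <= mu * x * n%:R)) => /= h1; last by rewrite /gnp_prob big1.
  case: (boolP (c * n%:R ^+ 2 <= #|D F|%:R)) => /= h2; last by rewrite /gnp_prob big1.
  case: (boolP [forall d in D F, _]) => /= [/forallP h3|_]; last by rewrite /gnp_prob big1.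
  apply: le_trans (gnp_lower p01 a01 _ _) _.
  - by move=> d dD; have := h3 d; rewrite dD => /andP[].
  - by move=> d dD; have := h3 d; rewrite dD => /andP[].
  rewrite exprMn mulrCA ler_wpM2l ?exprn_ge0 // /b /y -expRM_natl -expRD ler_expR.
  have l1 := ler_wpM2l lam0 h1.
  have l2 := ler_wpM2l (mulr_ge0 (sqr_ge0 a) p_ge0) h2.
  by move: l1 l2; rewrite /x; clear; lra.
rewrite -mulr_sumr (sum_sgraph (fun J => (p * y) ^+ #|J|)).
have -> : \sum_(J : {set {set V}} | J \subset vpairs n) (p * y) ^+ #|J| =
    \prod_(e in vpairs n) (p * y + 1).
  rewrite -(rs_sum_prod (vpairs n) (fun=> p * y) (fun=> 1)); apply: eq_bigr => J sJ.
  rewrite -big_mkcondr /= -prodr_const; apply: eq_bigl => e.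
  by case: (boolP (e \in J)) => [/(fintype.subsetP sJ) ->|]; rewrite ?andbF.
have hprod : \prod_(e in vpairs n) (p * y + 1) <= expR (p * y * n%:R ^+ 2).
  rewrite prodr_const; apply: (le_trans (_ : _ <= expR (p * y) ^+ #|vpairs n|)).
    apply: lerXn2r; rewrite ?nnegrE ?expR_ge0 ?addr_ge0 ?mulr_ge0 //.
    by rewrite addrC expR_ge1Dx.
  rewrite -expRM_natl ler_expR mulrC ler_wpM2l ?mulr_ge0 // -natrX ler_nat.
  exact: card_vpairs.
apply: (le_trans (ler_wpM2l (expR_ge0 _) hprod)).
(* The weight and the sum over graphs each cost at most [a^2 c/32 * x n]; half of the gain
   [a^2 c/8 * x n] remains, and it is at least [n]. *)
rewrite /b -expRD ler_expR.
have n0 : 0 <= n%:R :> R by [].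
have l1 := ler_wpM2r (mulr_ge0 x_ge0 n0) hmu.
have l2 := ler_wpM2r (mulr_ge0 x_ge0 n0) hlam.
have l3 := ler_wpM2r n0 hx.
by move: l1 l2 l3; clearbody y; rewrite /x; clear; lra.
Qed.

End Boosters.

(** Probabilistic method: a random subset of the edges, each kept with probability [theta], fails
    each of the two requirements with probability at most 1/4. *)
Lemma sparsify (R : realType) (n : nat) (G : sgraph n) (theta k m : R) :
  0 <= theta <= 1 -> (1 < n)%N -> #|edges G|%:R <= m * n%:R ->
  1 <= theta * m / 16 -> 3 <= theta * k / 32 ->
  exists J : sgraph n, [/\ subgraph J G, #|edges J|%:R <= 2 * theta * m * n%:R
    & forall D1 D2 : {set 'I_n}, k * n%:R <= (dcount G (setX D1 D2))%:R ->
      theta / 2 * (dcount G (setX D1 D2))%:R <= (dcount J (setX D1 D2))%:R].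
Proof.
move=> t01 n1 hm ht hk.
have t0 : 0 <= theta by case/andP: t01.
have nR : 2 <= n%:R :> R by rewrite ler_nat.
have n0 : 0 <= n%:R :> R by [].
pose w (D : {set 'I_n * 'I_n}) (J : {set {set 'I_n}}) : nat := (\sum_(e in J) mult D e)%N.
pose bad1 (J : {set {set 'I_n}}) : bool :=
  (1 + 1) * theta * (m * n%:R) <= (\sum_(e in J) 1)%:R.
pose bad2 (DD : {set 'I_n} * {set 'I_n}) (J : {set {set 'I_n}}) : bool :=
  (k * n%:R <= (dcount G (setX DD.1 DD.2))%:R) &&
  ((w (setX DD.1 DD.2) J)%:R <= (1 - 2^-1) * theta * (w (setX DD.1 DD.2) (edges G))%:R).
have e2 : expR (- n%:R) <= 1 / 4 :> R.
  by apply: le_trans (expRN2_le R); rewrite ler_expR lerN2.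
have b1 : rs_prob (edges G) theta bad1 <= 1 / 4.
  apply: (le_trans (@rs_upper _ _ _ _ t01 1 (fun=> 1%N) (m * n%:R) _ _ _)) => //.
  - by rewrite sum1_card.
  - by rewrite lexx ler01.
  apply: le_trans (expRN2_le R); rewrite ler_expR.
  by have := ler_wpM2r n0 ht; clear e2; nra.
have b2 : rs_prob (edges G) theta (fun J => [exists DD, bad2 DD J]) <= 1 / 4.
  apply: le_trans (rs_union _ t01 _) _.
  (* Each pair of sets fails with probability at most [expR (- 3n)], and there are
     [4^n <= expR (2n)] of them. *)
  apply: (le_trans (_ : _ <= \sum_(DD : {set 'I_n} * {set 'I_n}) expR (- (3 * n%:R)))).
    apply: ler_sum => -[A B] _; rewrite /bad2 /=.
    case: (boolP (k * n%:R <= _)) => /= hD; last first.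
      by apply: le_trans (expR_ge0 _); rewrite /rs_prob big1 // => J; rewrite andbF.
    have := @rs_lower _ _ (edges G) _ t01 2^-1 (mult (setX A B)) set0.
    rewrite cards0 expr0 mul1r => /(_ (finset.sub0set _) (mult_le2 _)) h.
    apply: le_trans (le_trans (h _ _) _).
    - by apply: rs_le => // J _; rewrite /w finset.sub0set.
    - by move=> e; rewrite inE.
    - by apply/andP; split; lra.
    rewrite ler_expR -dcountE.
    have l1 := ler_wpM2l t0 hD; have l2 := ler_wpM2r n0 hk.
    by move: l1 l2; clear h e2 b1; lra.
  rewrite sumr_const.
  have -> : #|{: {set 'I_n} * {set 'I_n}}| = (2 ^ (n + n))%N.
    by rewrite card_prod -!cardsT -powersetT card_powerset cardsT card_ord expnD.
  rewrite -[_ *+ _]mulr_natl.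
  apply: (le_trans (ler_wpM2r (expR_ge0 _) (exp2_le_expR R _))).
  apply: le_trans e2; rewrite -expRD ler_expR natrD; lra.
have [J sJ] : exists2 J : {set {set 'I_n}}, J \subset edges G & ~~ bad1 J && ~~ [exists DD, bad2 DD J].
  apply/exists2P; apply: contrapT => nex.
  have : 1 <= rs_prob (edges G) theta bad1 + rs_prob (edges G) theta (fun J => [exists DD, bad2 DD J]).
    rewrite -(rs_total (edges G) theta).
    apply: le_trans (_ : rs_prob (edges G) theta (fun J => [exists b : bool, if b then bad1 J else [exists DD, bad2 DD J]]) <= _).
      apply: rs_le => // J sJ _; apply/existsP; apply: contrapT => h; apply: nex; exists J; split=> //.
      apply/andP; split; apply/negP => hb; apply: h; [by exists true|by exists false].
    apply: le_trans (rs_union _ t01 _) _; by rewrite big_bool.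
  by clear e2; lra.
rewrite negb_exists => /andP[nb1 /forallP nb2].
have sJV : J \subset vpairs n by apply: fintype.subset_trans sJ _; case: (G).
exists (SGraph sJV); split => //.
  have -> : edges (SGraph sJV) = J by [].
  move: nb1; rewrite /bad1 sum1_card -ltNge => /ltW nb1; clear e2 b1 b2 nb2; lra.
move=> A B hAB; have := nb2 (A, B); rewrite /bad2 /= hAB /= -ltNge /w -dcountE => /ltW h.
rewrite [(dcount (SGraph _) _)]dcountE /=; clear e2 b1 b2 nb1 nb2; lra.
Qed.

(** * Boosters *)

Section BoosterGraph.
Variable n : nat.
Notation V := 'I_n.
Implicit Types (F : sgraph n).

(** The number of vertices on a longest path; it is at most [n], so the maximum ranges over
    [k < n.+1]. *)
Definition plen F : nat :=
  \max_(k < n.+1 | `[< exists2 q : seq V, upath (adj F) q & size q = k >]) k.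

Lemma plen_max F (q : seq V) : upath (adj F) q -> (size q <= plen F)%N.
Proof.
move=> uq; have sz : (size q < n.+1)%N.
  by rewrite ltnS -[n in (_ <= n)%N]card_ord; case/andP: uq => /card_uniqP <- _; apply: max_card.
apply: (@leq_bigmax_cond _ _ (fun k : 'I_n.+1 => k : nat) (Ordinal sz)).
by apply/asboolP; exists q.
Qed.

Lemma plen_ex F : exists2 q : seq V, upath (adj F) q & size q = plen F.
Proof.
have h0 : `[< exists2 q : seq V, upath (adj F) q & size q = @ord0 n >] by apply/asboolP; exists [::].
by rewrite /plen (bigop.bigmax_eq_arg ord0) //; case: arg_maxnP => // k /asboolP[q uq sz] _; exists q.
Qed.

Lemma plen_le F : (plen F <= n)%N.
Proof. by apply/bigmax_leqP => k _; rewrite -ltnS. Qed.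

Definition ends F (u : V) : {set V} :=
  [set v | `[< exists q, [/\ upath (adj F) (v :: q), size (v :: q) = plen F & last v q = u] >]].

Definition boost_src F : {set V} := [set u | (n <= 3 * #|ends F u|)%N].

(** The boosters: joining the two ends of a longest path closes a cycle. They are ordered pairs, to
    be counted by [dcount] from their sources. *)
Definition boost F : {set V * V} := [set d | (d.1 \in boost_src F) && (d.2 \in ends F d.1)].

Lemma card_boost F : #|boost F| = (\sum_(u in boost_src F) #|ends F u|)%N.
Proof.
rewrite -sum1_card (partition_big fst (mem (boost_src F))) /=; last first.
  by move=> d; rewrite [in X in X -> _]inE => /andP[].
apply: eq_bigr => u uA; rewrite -sum1_card.
rewrite (reindex_onto (fun v => (u, v)) snd) /=; last by move=> [a b] /andP[_ /eqP /= ->].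
by apply: eq_bigl => v; rewrite !eqxx !andbT [in LHS]inE /= uA.
Qed.

Lemma hamiltonian_cycle F (c : seq V) : (2 < n)%N -> size c = n -> ucycleb (adj F) c -> hamiltonian F.
Proof.
move=> n2 sz uc; rewrite /hamiltonian n2 /=; apply/existsP.
have sz' : size c == n by apply/eqP.
by exists (Tuple sz').
Qed.

Lemma hamiltonian_sub F F' : subgraph F F' -> hamiltonian F -> hamiltonian F'.
Proof.
move=> s /andP[n2 /existsP[c /andP[cy uc]]]; rewrite /hamiltonian n2; apply/existsP; exists c.
by rewrite /ucycleb uc andbT; apply: sub_cycle cy => u v; apply: adj_sub.
Qed.

Variables (B G G' : sgraph n) (high : pred V) (D1 K t : nat).
Hypothesis BG' : subgraph B G'.
Hypothesis G'G : subgraph G' G.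
Hypothesis few_low2 : forall s, high s ->
  (#|[set v | adj G s v && [exists y, [&& y != s, adj G v y & ~~ high y]]]| <= 1)%N.
Hypothesis low_uniq : forall v y y', adj G v y -> adj G v y' -> ~~ high y -> ~~ high y' -> y = y'.
Hypothesis expand : forall U : {set V}, (forall u, u \in U -> high u) -> (#|U| <= D1)%N ->
  ((2 * K + 3) * #|U| <= #|nbrs (adj B) U :\: U|)%N.
Hypothesis dense : forall X Y : {set V}, (D1 < #|X|)%N -> (n <= 3 * #|Y|)%N ->
  exists2 x, x \in X & (t < #|[set v | adj B x v] :&: Y|)%N.
Hypothesis Kt : (n < K ^ t)%N.
Hypothesis mindeg2 : forall v, (1 < #|[set u | adj B v u]|)%N.
Hypothesis n2 : (2 < n)%N.

(** * Graphs between [B] and [G']: low-vertex conditions descend from [G], expansion ascends from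
    [B] *)

Section Extension.
Variable F : sgraph n.
Hypothesis BF : subgraph B F.
Hypothesis FG' : subgraph F G'.

Let FG : subgraph F G. Proof. exact: fintype.subset_trans FG' G'G. Qed.

Let few_low2F s : high s ->
  (#|[set v | adj F s v && [exists y, [&& y != s, adj F v y & ~~ high y]]]| <= 1)%N.
Proof.
move=> hs; apply: leq_trans (few_low2 hs); apply: subset_leq_card; apply/fintype.subsetP => v.
rewrite !inE => /andP[sv /existsP[y /and3P[ys vy hy]]]; rewrite (adj_sub FG sv) /=.
by apply/existsP; exists y; rewrite ys hy (adj_sub FG vy).
Qed.

Let expandF (U : {set V}) : (forall u, u \in U -> high u) -> (#|U| <= D1)%N ->
  ((2 * K + 3) * #|U| <= #|nbrs (adj F) U :\: U|)%N.
Proof.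
move=> hU cU; apply: leq_trans (expand hU cU) _; apply: subset_leq_card; apply: finset.setSD.
apply/bigcupsP => u uU; apply/fintype.subsetP => v; rewrite inE => uv.
by apply/bigcupP; exists u; rewrite // inE (adj_sub BF uv).
Qed.

Let denseF (X Y : {set V}) : (D1 < #|X|)%N -> (#|V| <= 3 * #|Y|)%N ->
  exists2 x, x \in X & (t < #|[set v | adj F x v] :&: Y|)%N.
Proof.
rewrite card_ord => hX hY; have [u uX h] := dense hX hY; exists u => //; apply: leq_trans h _.
apply: subset_leq_card; apply: finset.setSI; apply/fintype.subsetP => v.
by rewrite !inE => /(adj_sub BF).
Qed.

Let KtF : (#|V| < K ^ t)%N. Proof. by rewrite card_ord. Qed.

Let mindeg2F v : (1 < #|[set u | adj F v u]|)%N.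
Proof.
apply: leq_trans (mindeg2 v) _; apply: subset_leq_card; apply/fintype.subsetP => u.
by rewrite !inE => /(adj_sub BF).
Qed.

Let low_uniqF v y y' : adj F v y -> adj F v y' -> ~~ high y -> ~~ high y' -> y = y'.
Proof. by move=> h1 h2; apply: (@low_uniq v); apply: adj_sub FG _. Qed.

Lemma card_ends s q : upath (adj F) (s :: q) -> size (s :: q) = plen F ->
  (n <= 3 * #|ends F (last s q)|)%N.
Proof.
move=> up sz.
have := many_ends (@adj_sym _ F) (@adj_irr _ F) (@plen_max F) few_low2F expandF denseF KtF
  mindeg2F low_uniqF up sz.
by rewrite card_ord.
Qed.

Lemma closed_full (C : {set V}) : C != set0 ->
  (forall u v, u \in C -> adj F u v -> v \in C) -> C = setT.
Proof. exact: (closed_setT (@adj_sym _ F) expandF denseF KtF mindeg2F low_uniqF). Qed.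

Lemma plen_ge3 : (2 < plen F)%N.
Proof.
have v0 : V by exists 0%N; lia.
have [u uv] : exists u, u \in [set u | adj F v0 u].
  by apply/set0Pn; rewrite -card_gt0; apply: ltnW.
have [w] : exists w, w \in [set u | adj F v0 u] :\ u.
  by apply/set0Pn; rewrite -card_gt0; have := mindeg2F v0; rewrite (cardsD1 u) uv.
move: uv; rewrite !inE => vu /andP[wu vw].
apply: (@plen_max F [:: u; v0; w]).
have ne a b : adj F a b -> a != b by apply: contraTneq => ->; rewrite adj_irr.
by rewrite /upath /= !inE negb_or eq_sym (ne _ _ vu) eq_sym wu (ne _ _ vw) adj_sym vu vw.
Qed.

(** A longest path ending in [u] can be rotated to start at any of at least [n/3] vertices [v].
    Reversed, it ends in [v], so each such [v] in turn has at least [n/3] endpoints. *)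
Lemma card_boost_src : (n <= 3 * #|boost_src F|)%N.
Proof.
have [[|s q] up sz] := plen_ex F; first by have := plen_ge3; rewrite -sz.
apply: leq_trans (card_ends up sz) _; rewrite leq_mul2l /=; apply: subset_leq_card.
apply/fintype.subsetP => v; rewrite !inE => /asboolP[r [ur sr lr]].
have E : rev (v :: r) = last v r :: behead (rev (v :: r)).
  by case/lastP: r {ur sr lr} => [//|r w]; rewrite -rcons_cons rev_rcons last_rcons.
have ur' : upath (adj F) (last v r :: behead (rev (v :: r))).
  by rewrite -E upath_rev //; apply: adj_sym.
have sr' : size (last v r :: behead (rev (v :: r))) = plen F by rewrite -E size_rev.
have := card_ends ur' sr'.
have -> // : last (last v r) (behead (rev (v :: r))) = v.
rewrite -[LHS]/(last v (last v r :: behead (rev (v :: r)))) -E.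
by rewrite rev_cons last_rcons.
Qed.

Lemma boost_extend F' u v : (u, v) \in boost F -> subgraph F F' -> subgraph F' G' -> adj F' u v ->
  (forall C : {set V}, C != set0 -> (forall a b, a \in C -> adj F' a b -> b \in C) -> C = setT) ->
  hamiltonian F' \/ (plen F < plen F')%N.
Proof.
rewrite inE => /andP[_]; rewrite inE => /asboolP[q [up sz lq]] FF' _ uv con.
have up' : upath (adj F') (v :: q) by apply: upath_sub up => a b; apply: adj_sub.
have vl : adj F' v (last v q) by rewrite lq adj_sym.
have [[szn cy]|[r ur sr]] := cycle_extend (@adj_sym _ F') con up' vl.
  by left; apply: hamiltonian_cycle cy; rewrite // szn card_ord.
by right; rewrite -sz -sr; apply: plen_max.
Qed.

(** A booster already present would, by [boost_extend] with [F' = F], make [F] Hamiltonian or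
    [plen F] larger than itself. *)
Lemma boost_avoid u v : ~~ hamiltonian F -> (u, v) \in boost F -> (u != v) && ~~ adj F u v.
Proof.
move=> nh uv; apply/andP; split.
  move: uv; rewrite inE => /andP[_]; rewrite inE /= => /asboolP[q [/andP[uq _] sz lq]].
  apply: contraTneq plen_ge3 => uv; rewrite -sz; case: q uq lq {sz} => [//|w q] uq lq.
  by move: uq; rewrite cons_uniq -{1}uv -lq /= mem_last.
apply/negP => auv.
have [h|] := boost_extend uv (fintype.subxx _) FG' auv closed_full; first by rewrite h in nh.
by rewrite ltnn.
Qed.

End Extension.

Hypothesis boosters : forall F, subgraph B F -> subgraph F G' -> (#|edges F| <= #|edges B| + n)%N ->
  (forall d, d \in boost F -> (d.1 != d.2) && ~~ adj F d.1 d.2) -> (n <= 3 * #|boost_src F|)%N ->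
  exists2 d, d \in boost F & adj G' d.1 d.2.

Lemma boosted_hamiltonian : hamiltonian G'.
Proof.
(* Each round adds one booster and lengthens the longest path; [i = n.+1] exceeds every path length
   and so leaves only the Hamiltonian case. *)
have step i : (i <= n.+1)%N -> exists F, [/\ subgraph B F, subgraph F G',
    (#|edges F| <= #|edges B| + i)%N & hamiltonian F \/ (i <= plen F)%N].
  elim: i => [_|i IH hi]; first by exists B; split; rewrite ?addn0 ?/subgraph ?fintype.subxx //; right.
  have [F [BF FG' cF hF]] := IH (ltnW hi).
  have cF' : (#|edges F| <= #|edges B| + i.+1)%N by apply: leq_trans cF _; rewrite leq_add2l.
  have [h|nh] := boolP (hamiltonian F); first by exists F; split=> //; left.
  case: hF => [h|hF]; first by rewrite h in nh.
  have [[u v] uvB uvG'] : exists2 d, d \in boost F & adj G' d.1 d.2.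
    apply: boosters => //.
    - by apply: leq_trans cF _; rewrite leq_add2l -ltnS.
    - by move=> [u v] /(boost_avoid BF FG' nh).
    - exact: card_boost_src BF FG'.
  have sV : [set u; v] |: edges F \subset vpairs n.
    apply: fintype.subset_trans (_ : edges G' \subset _); last by case: (G').
    by rewrite subUset sub1set; apply/andP.
  pose F' := SGraph sV.
  have FF' : subgraph F F' by apply: subsetUr.
  have F'G' : subgraph F' G' by rewrite /subgraph subUset sub1set; apply/andP.
  have BF' : subgraph B F' by apply: fintype.subset_trans BF FF'.
  exists F'; split => //.
    by rewrite addnS -addn1 addnC; apply: leq_trans (leq_card_setU _ _).1 _; rewrite cards1 leq_add2l.
  have auv : adj F' u v by rewrite /adj inE set11.
  have [h|h] := boost_extend uvB FF' F'G' auv (closed_full BF' F'G'); first by left.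
  by right; apply: leq_ltn_trans h.
have [F [_ FG' _ [h|]]] := step n.+1 (leqnn _); first exact: hamiltonian_sub h.
by rewrite ltnNge plen_le.
Qed.

End BoosterGraph.

(** * Resilience *)

(* [lra] would otherwise try to identify the distinct counts up to conversion. *)
Ltac lra_dcount := repeat match goal with
  |- context [dcount ?G ?D] => move: (dcount G D) => ? end; lra.

Section Deterministic.
Variables (R : realType) (n : nat) (p eps theta eta d d1 d3 : R) (K t : nat) (G H : sgraph n).
Let x := n%:R * p.
Notation V := 'I_n.
Notation Low := (low p G).
Let G' := del G H.

Hypothesis p01 : 0 <= p <= 1.
Hypothesis eps01 : 0 < eps <= 1 / 10.
Hypothesis theta0 : 0 < theta <= 1 / 300.
Hypothesis eta0 : 0 < eta.
Hypothesis d3_gt0 : 0 < d3.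
Hypothesis d3_le : d3 <= eps * d1.
Hypothesis d1_le : d1 <= 1 / 3.
Hypothesis d_ge : (2 * K + 4)%:R * d1 <= d.
Hypothesis eta_le : (2 * K + 4)%:R * eta <= theta.
Hypothesis Kt : (n < K ^ t)%N.
Hypothesis t_lt : t%:R < theta * eps / 8 * x.
Hypothesis n_large : 100 <= eps * n%:R.
Hypothesis x_large : 3 <= theta * x.
Hypothesis x_large2 : 3 <= theta * (eps / 4 * d1 * x) / 32.
Hypothesis x_large3 : 1 <= theta * x / 16.

Hypothesis dense_pairs : forall A B : {set V}, d3 * n%:R <= #|A|%:R -> d3 * n%:R <= #|B|%:R ->
  (1 - eps / 10) * p * #|offdiag A B|%:R < (dcount G (offdiag A B))%:R.
Hypothesis degree_sum : forall A : {set V}, d1 * n%:R <= #|A|%:R ->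
  (dcount G (setX A [set: V]))%:R < (1 + eps / 10) * p * #|setX A [set: V]|%:R.
Hypothesis small_sets : forall A : {set V}, A != set0 -> #|A|%:R <= d * n%:R ->
  (dcount G (setX A A))%:R < eta * x * #|A|%:R.
Hypothesis no_clash : ~~ [|| clash_edge p G, clash_cherry p G, clash_cycle p G | clash_path p G].
Hypothesis boosters : forall F : sgraph n, #|edges F|%:R <= 6 * theta * x * n%:R ->
  9^-1 * n%:R ^+ 2 <= #|boost F|%:R :> R ->
  (forall e, e \in boost F -> (e.1 != e.2) && ~~ adj F e.1 e.2) -> subgraph F G ->
  (1 - eps / 10) * p * #|boost F|%:R < (dcount G (boost F))%:R.

Hypothesis HG : subgraph H G.
Hypothesis Hdeg : forall v, (deg H v)%:R <= dtilde (x / 100) eps G v.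

Let p_ge0 : 0 <= p. Proof. by case/andP: p01. Qed.
Let n0 : 0 <= n%:R :> R. Proof. by []. Qed.
Let x_ge0 : 0 <= x. Proof. by rewrite mulr_ge0. Qed.
Let th0 : 0 < theta. Proof. by case/andP: theta0. Qed.
Let x_ge900 : 900 <= x.
Proof.
case/andP: theta0 => h1 h2.
have h : theta * x <= 1 / 300 * x by rewrite ler_wpM2r.
by move: x_large; lra.
Qed.
Let n_ge1000 : 1000 <= n%:R :> R.
Proof.
case/andP: eps01 => h1 h2.
have h : eps * n%:R <= 1 / 10 * n%:R by rewrite ler_wpM2r.
by move: n_large; lra.
Qed.
Let d1_gt0 : 0 < d1.
Proof. by case/andP: eps01 => h1 _; have := lt_le_trans d3_gt0 d3_le; rewrite pmulr_rgt0. Qed.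
Let d3_le1 : d3 <= d1.
Proof.
apply: le_trans d3_le _; rewrite ler_piMl // ?ltW //.
by case/andP: eps01 => h1 h2; lra.
Qed.
Let px : p <= eps / 100 * x.
Proof. by have := ler_wpM2l p_ge0 n_large; rewrite /x; lra. Qed.

(** Otherwise [dense_pairs] would give the low vertices an average degree of at least [x/4]. *)
Lemma few_low : #|Low|%:R < d3 * n%:R.
Proof.
rewrite ltNge; apply/negP => hL; have nn := n_ge1000.
have hT : d3 * n%:R <= #|[set: V]|%:R.
  rewrite cardsT card_ord ler_piMl //; apply: le_trans d3_le1 _; apply: le_trans d1_le _; lra.
have h1 := dense_pairs hL hT.
have h2 := card_offdiag R Low [set: V].
rewrite cardsT card_ord in h2.
have h3 : (dcount G (offdiag Low [set: V]) <= dcount G (setX Low [set: V]))%N.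
  apply: subset_leq_card; apply/fintype.subsetP => e; rewrite !inE => /andP[/andP[/andP[-> _] _] ->].
  by [].
have h4 : (dcount G (setX Low [set: V]))%:R <= #|Low|%:R * (x / 100).
  by rewrite dcount_deg natr_sum mulr_natl -sumr_const; apply: ler_sum => v; rewrite inE => /ltW.
have h5 : #|Low|%:R * (n%:R / 2) <= #|offdiag Low [set: V]|%:R :> R.
  by apply: le_trans h2; rewrite ler_wpM2l //; lra.
have h6 : 1 / 2 * p * (#|Low|%:R * (n%:R / 2)) <= (1 - eps / 10) * p * #|offdiag Low [set: V]|%:R.
  apply: ler_pM => //; rewrite ?mulr_ge0 //; try lra.
  by apply: ler_pM => //; case/andP: eps01 => e1 e2; lra.
have h7 : (dcount G (offdiag Low [set: V]))%:R <= (dcount G (setX Low [set: V]))%:R :> R.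
  by rewrite ler_nat.
have L0 : 0 <= #|Low|%:R * x by rewrite mulr_ge0.
have h8 : 1 / 2 * p * (#|Low|%:R * (n%:R / 2)) = #|Low|%:R * x / 4 by rewrite /x; field.
by move: h1 h4 h6 h7 L0; rewrite h8; lra_dcount.
Qed.

Lemma deg_del v : (deg G v <= deg G' v + deg H v)%N.
Proof.
apply: leq_trans (leq_card_setU _ _).1; apply: subset_leq_card; apply/fintype.subsetP => u.
by rewrite !inE /adj inE => ->; rewrite andbT orNb.
Qed.

(** One linear bound for both kinds of vertices; a low vertex loses fewer than [x/100] edges, which
    is negligible in total. *)
Lemma degH_le v : (deg H v)%:R <= (1 / 3 - eps) * (deg G v)%:R + (v \in Low)%:R * (x / 100).
Proof.
case/andP: eps01 => e0 e1.
have g0 : 0 <= (deg G v)%:R :> R by [].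
have g1 : 0 <= (1 / 3 - eps) * (deg G v)%:R by rewrite mulr_ge0 //; lra.
apply: le_trans (Hdeg v) _; rewrite /dtilde -[low_deg _ _]/Low.
case: (boolP (v \in Low)) => hv; last by rewrite mul0r addr0 mulrC div1r.
have hv' : (deg G v)%:R < x / 100 by move: hv; rewrite inE.
rewrite [X in _ <= _ + X]mul1r; apply: (le_trans (_ : _ <= x / 100)); last by rewrite lerDr.
by apply: le_trans (ltW hv'); rewrite lerBlDr lerDl.
Qed.

(** [H] takes at most [1/3 - eps] of a degree sum below [(1 + eps/10) x |A|]. Low vertices add at
    most [eps/100 * x |A|], as [|Low| <= d3 n <= eps |A|]. *)
Lemma degH_sum (A : {set V}) : d1 * n%:R <= #|A|%:R ->
  (dcount H (setX A [set: V]))%:R <= (1 / 3 - eps / 2) * x * #|A|%:R.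
Proof.
move=> hA; case/andP: eps01 => e0 e1.
have e3 : 0 <= 1 / 3 - eps by lra.
have h1 := degree_sum hA.
have h2 : (dcount H (setX A [set: V]))%:R <=
    (1 / 3 - eps) * (dcount G (setX A [set: V]))%:R + #|Low|%:R * (x / 100).
  rewrite !dcount_deg !natr_sum mulr_sumr.
  apply: (le_trans (ler_sum _ (fun v _ => degH_le v))).
  rewrite big_split /= lerD2l -mulr_suml ler_wpM2r ?divr_ge0 //.
  rewrite -natr_sum ler_nat -sum1_card big_mkcond [leqRHS]big_mkcond /=.
  by apply: leq_sum => v _; case: (v \in A); case: (v \in Low).
have h3 := few_low.
rewrite cardsX cardsT card_ord natrM in h1.
have A0 : 0 <= #|A|%:R :> R by [].
have xA : 0 <= x * #|A|%:R by rewrite mulr_ge0.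
have h4 : (1 / 3 - eps) * (dcount G (setX A [set: V]))%:R <= (1 / 3 - eps) * ((1 + eps / 10) * (x * #|A|%:R)).
  apply: ler_wpM2l => //; apply: ltW; apply: lt_le_trans h1 _.
  by rewrite [_ * (x * _)](_ : _ = (1 + eps / 10) * p * (#|A|%:R * n%:R)) // /x; ring.
have h5 : #|Low|%:R * (x / 100) <= eps / 100 * (x * #|A|%:R).
  have : #|Low|%:R <= eps * #|A|%:R.
    apply: le_trans (ltW h3) _; apply: (le_trans (_ : _ <= eps * d1 * n%:R)); first by rewrite ler_wpM2r.
    by rewrite -mulrA ler_wpM2l // ltW.
  move=> /(ler_wpM2r x_ge0); lra.
have h6 : (1 / 3 - eps) * ((1 + eps / 10) * (x * #|A|%:R)) + eps / 100 * (x * #|A|%:R) <=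
   (1 / 3 - eps / 2) * x * #|A|%:R.
  rewrite [leRHS](_ : _ = (1 / 3 - eps / 2) * (x * #|A|%:R)); last by ring.
  rewrite [(1 / 3 - eps) * _]mulrA -mulrDl ler_wpM2r //; clear h1 h2 h3 h4 h5; nra.
by move: h1 h2 h4 h5 h6; lra_dcount.
Qed.

(** [G] has at least [(1/3 - eps/4) x |A|] edges from [A] to [B], while [H] has at most
    [(1/3 - eps/2) x |A|] edges at [A] altogether. *)
Lemma dense_del (A B : {set V}) : d1 * n%:R <= #|A|%:R -> (n <= 3 * #|B|)%N ->
  eps / 4 * x * #|A|%:R <= (dcount G' (setX A B))%:R.
Proof.
move=> hA; rewrite -(ler_nat R) natrM => hB; case/andP: eps01 => e0 e1.
have hA' : d3 * n%:R <= #|A|%:R by apply: le_trans hA; rewrite ler_wpM2r.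
have hB' : d3 * n%:R <= #|B|%:R.
  apply: (le_trans (_ : _ <= 1 / 3 * n%:R)); last by lra.
  by rewrite ler_wpM2r //; apply: le_trans d3_le1 d1_le.
have h1 := dense_pairs hA' hB'.
have h2 := card_offdiag R A B.
have h3 : (dcount G (offdiag A B))%:R <= (dcount G (setX A B))%:R :> R.
  by rewrite ler_nat; apply: subset_leq_card; apply/fintype.subsetP => e; rewrite !inE => /andP[/andP[-> _] ->].
have h4 : (dcount G (setX A B))%:R <= (dcount G' (setX A B))%:R + (dcount H (setX A B))%:R :> R.
  by rewrite -natrD ler_nat; apply: dcount_del.
have h5 : (dcount H (setX A B))%:R <= (dcount H (setX A [set: V]))%:R :> R.
  rewrite ler_nat; apply: subset_leq_card; apply/fintype.subsetP => e; rewrite !inE => /andP[/andP[-> _] ->].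
  by [].
have h6 := degH_sum hA.
have A0 : 0 <= #|A|%:R :> R by [].
have xA : 0 <= x * #|A|%:R by rewrite mulr_ge0.
have h7 : #|A|%:R * (n%:R / 3 - 1) <= #|offdiag A B|%:R :> R.
  by apply: le_trans h2; rewrite ler_wpM2l //; lra.
have h8 : (1 - eps / 10) * (p * (#|A|%:R * (n%:R / 3 - 1))) <= (1 - eps / 10) * (p * #|offdiag A B|%:R).
  by rewrite ler_wpM2l ?ler_wpM2l //; lra.
have h9 : (1 / 3 - eps / 100) * (x * #|A|%:R) <= p * (#|A|%:R * (n%:R / 3 - 1)).
  by have := ler_wpM2r A0 px; rewrite /x; lra.
have h10 : (1 - eps / 10) * ((1 / 3 - eps / 100) * (x * #|A|%:R)) <= (1 - eps / 10) * (p * (#|A|%:R * (n%:R / 3 - 1))).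
  by rewrite ler_wpM2l //; lra.
have h11 : (1 / 3 - eps / 4) * (x * #|A|%:R) <= (1 - eps / 10) * ((1 / 3 - eps / 100) * (x * #|A|%:R)).
  by rewrite [leRHS]mulrA ler_wpM2r //; clear h1 h2 h3 h4 h5 h6 h7 h8 h9 h10; nra.
have h12 : (1 / 3 - eps / 4) * (x * #|A|%:R) <= (dcount G (setX A B))%:R.
  apply: le_trans h11 (le_trans h10 (le_trans h8 _)).
  by rewrite [_ * (p * _)]mulrA; apply: le_trans (ltW h1) h3.
rewrite -[eps / 4 * x * _]mulrA; rewrite -[_ * x * _]mulrA in h6.
clear h1 h3 h8 h9 h10 h11; move: h4 h5 h6 h12; move: (x * _) => y.
by lra_dcount.
Qed.

Let m0 : nat := (Num.truncn (theta * x)).+1.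
(** At a low vertex two edges are all that [H] is certain to leave. *)
Let pick_nbrs v : {set V} := [set u in take (if v \in Low then 2%N else m0) (enum [set u | adj G' v u])].

Lemma m0_bounds : theta * x <= m0%:R <= theta * x + 1.
Proof.
have h : 0 <= theta * x by rewrite mulr_ge0 // ltW.
have := truncn_itv h; rewrite -/m0 => /andP[h1 h2]; rewrite ltW //=.
by rewrite /m0 -natr1 lerD2r.
Qed.

(** Enough neighbours remain in [G']: a high vertex keeps two thirds of at least [x/100], and
    [x/150 >= theta x + 1] because [theta <= 1/300] and [x >= 900]. *)
Lemma pick_nbrsE v : #|pick_nbrs v| = if v \in Low then 2%N else m0.
Proof.
rewrite cardsE (card_uniqP _) ?take_uniq ?enum_uniq //; set m := if _ then _ else _.
suff h : (m <= deg G' v)%N by rewrite size_takel // -cardE.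
rewrite /m; have hd := deg_del v; have hH := Hdeg v; move: hH; rewrite /dtilde -[low_deg _ _]/Low.
case: (boolP (v \in Low)) => hv hH.
  rewrite lerBrDr -natrD ler_nat in hH.
  by have := leq_trans hH hd; rewrite addnC leq_add2r.
rewrite -(ler_nat R); case/andP: m0_bounds => _ hm; apply: le_trans hm _.
have dG : x / 100 <= (deg G v)%:R by move: hv; rewrite inE -leNgt.
have hd' : (deg G v)%:R <= (deg G' v)%:R + (deg H v)%:R :> R by rewrite -natrD ler_nat.
case/andP: eps01 => e0 e1; case/andP: theta0 => t0 t1.
have h1 : theta * x <= 1 / 300 * x by rewrite ler_wpM2r.
have h2 : (deg G v)%:R * (3^-1 - eps) <= (deg G v)%:R * 3^-1 by rewrite ler_wpM2l //; lra.
by move: x_ge900 hd' hH h1 h2 dG; lra.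
Qed.

Lemma pick_nbrs_sub v u : u \in pick_nbrs v -> adj G' v u.
Proof. by rewrite inE => /mem_take; rewrite mem_enum inE. Qed.

Lemma resilient_hamiltonian : hamiltonian G'.
Proof.
have nn := n_ge1000; have xx := x_ge900; have xl := x_large; have xl3 := x_large3; have d1l := d1_le.
case/andP: eps01 => e0 e1; case/andP: theta0 => t0 t1.
have e4 : 1 / 3 - eps / 2 < (1 - eps / 10) / 3 by lra.
have e5 : 0 <= 1 - eps / 10 by lra.
have x0 : 0 < x by lra.
have G'G : subgraph G' G by apply: finset.subsetDl.
have eG' : #|edges G'|%:R <= 2 * x * n%:R.
  have hT : d1 * n%:R <= #|[set: V]|%:R by rewrite cardsT card_ord ler_piMl //; lra.
  have := degree_sum hT; rewrite cardsX !cardsT card_ord natrM => h.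
  have h1 : (#|edges G'| <= dcount G (setX [set: V] [set: V]))%N.
    rewrite dcountE; apply: (@leq_trans #|edges G|); first exact: subset_leq_card.
    rewrite -sum1_card; apply: leq_sum => e eG; rewrite /mult card_gt0.
    have : e \in vpairs n by move: eG; case: (G) => E /= sE; apply: (fintype.subsetP sE).
    rewrite inE => /cards2P[u [v [_ ->]]].
    by apply/set0Pn; exists (u, v); rewrite !inE eqxx.
  have h2 : #|edges G'|%:R <= (dcount G (setX [set: V] [set: V]))%:R :> R by rewrite ler_nat.
  have xn : 0 <= x * n%:R by rewrite mulr_ge0.
  have h3 : (1 + eps / 10) * (x * n%:R) <= 2 * (x * n%:R) by rewrite ler_wpM2r //; lra.
  apply: le_trans h2 _; apply: le_trans (ltW h) _; apply: le_trans (_ : _ <= 2 * (x * n%:R)) _.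
    by apply: le_trans h3; rewrite /x; lra.
  by rewrite mulrA.
have n1 : (1 < n)%N by rewrite -(ltr_nat R); lra.
have [J [JG' cJ dJ]] := @sparsify R n G' theta (eps / 4 * d1 * x) (2 * x) ltac:(apply/andP; split; lra)
  n1 eG' ltac:(lra) x_large2.
pose Eb : {set {set V}} := edges J :|: \bigcup_(v : V) [set [set v; u] | u in pick_nbrs v].
have sEb : Eb \subset edges G'.
  rewrite subUset [edges J \subset _]JG'; apply/bigcupsP => v _; apply/fintype.subsetP => e /imsetP[u uv ->].
  exact: pick_nbrs_sub.
have sEV : Eb \subset vpairs n by apply: fintype.subset_trans sEb _; case: (G').
pose B := SGraph sEV.
have BG' : subgraph B G' by [].
have JB : subgraph J B by apply: subsetUl.
have pickB v : pick_nbrs v \subset [set u | adj B v u].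
  apply/fintype.subsetP => u uv; rewrite inE /adj inE; apply/orP; right.
  by apply/bigcupP; exists v => //; apply/imsetP; exists u.
have degB v : (#|pick_nbrs v| <= #|[set u | adj B v u]|)%N by apply: subset_leq_card.
case/andP: m0_bounds => hm1 hm2.
have m0_ge2 : (2 <= m0)%N by rewrite -(ler_nat R); lra.
(* The sample has at most [4 theta x n] edges and the chosen neighbours add at most
   [(theta x + 1) n]. The extra [n] leaves room for the boosters added later. *)
have cB : #|edges B|%:R + n%:R <= 6 * theta * x * n%:R.
  have c1 : (#|edges B| <= #|edges J| + \sum_(v : V) m0)%N.
    apply: leq_trans (leq_card_setU _ _).1 _; rewrite leq_add2l.
    apply: leq_trans (card_bigcup_le _ _) _.
    apply: leq_sum => v _; apply: leq_trans (leq_imset_card _ _) _.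
    by rewrite pick_nbrsE; case: ifP.
  rewrite sum_nat_const card_ord -(ler_nat R) natrD natrM in c1.
  have c2 := ler_wpM2l n0 hm2.
  have c3 := ler_wpM2r n0 x_large.
  by move: c1 c2 c3 cJ; lra.
pose D1 := Num.truncn (d1 * n%:R).
have dn0 : 0 <= d1 * n%:R by rewrite mulr_ge0 // ltW.
have := truncn_itv dn0; rewrite -/D1 => /andP[D1a D1b].
have D1lt (X : {set V}) : (D1 < #|X|)%N -> d1 * n%:R <= #|X|%:R.
  by rewrite -(ler_nat R) => h; apply: ltW; apply: lt_le_trans h.
have [nc1 nc2 nc3 nc4] : [/\ ~~ clash_edge p G, ~~ clash_cherry p G, ~~ clash_cycle p G & ~~ clash_path p G].
  by move: no_clash; rewrite !negb_or => /and4P[].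
have low_uniq v y y' : adj G v y -> adj G v y' -> ~~ (y \notin Low) -> ~~ (y' \notin Low) -> y = y'.
  move=> vy vy' /negPn ly /negPn ly'; apply/eqP; apply: contraNT nc2 => yy'.
  have ne a b : adj G a b -> a != b by apply: contraTneq => ->; rewrite adj_irr.
  apply/existsP; exists (v, y, y'); rewrite /= !(in_cons, in_nil, orbF) !negb_or vy vy' ly ly' yy' (ne _ _ vy) (ne _ _ vy').
  by [].
(* Two such neighbours [v], [w] with low vertices [y], [z] behind them form a 4-cycle if [y = z], a
   low edge if [y = w] or [z = v], and otherwise a path of length four. *)
have few_low2 s : s \notin Low ->
    (#|[set v | adj G s v && [exists y, [&& y != s, adj G v y & ~~ (y \notin Low)]]]| <= 1)%N.
  move=> hs; have ne a b : adj G a b -> a != b by apply: contraTneq => ->; rewrite adj_irr.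
  apply/card_le1_eqP => v w; rewrite !inE => /andP[sv /existsP[y /and3P[ys vy /negPn ly]]].
  case/andP=> sw /existsP[z /and3P[zs wz /negPn lz]].
  apply/eqP; apply/negPn/negP => wv.
  have vw : v != w by rewrite eq_sym.
  have [yz|yz] := eqVneq y z.
    subst z; case/negP: nc3; apply/existsP; exists (s, y, v, w).
    rewrite /= !(in_cons, in_nil, orbF) !negb_or sv sw vw ly (adj_sym G y) vy (adj_sym G y) wz (eq_sym s y) ys.
    by rewrite (ne _ _ sv) (ne _ _ sw) (eq_sym y v) (ne _ _ vy) (eq_sym y w) (ne _ _ wz).
  have yw : y != w.
    apply: contraNneq nc1 => yw; apply/existsP; exists (w, z); rewrite /= !(in_cons, in_nil, orbF) (ne _ _ wz) wz lz.
    by rewrite -yw ly.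
  have zv : z != v.
    apply: contraNneq nc1 => zv; apply/existsP; exists (v, y); rewrite /= !(in_cons, in_nil, orbF) (ne _ _ vy) vy ly.
    by rewrite -zv lz.
  case/negP: nc4; apply/existsP; exists (s, v, w, y, z).
  rewrite /= !(in_cons, in_nil, orbF) !negb_or sv sw vy wz vw ly lz yz (ne _ _ sv) (ne _ _ sw) (ne _ _ vy) (ne _ _ wz).
  by rewrite (eq_sym s y) ys (eq_sym s z) zs (eq_sym v z) zv (eq_sym w y) yw.
(* If expansion fails, [U] with its neighbours is a set [A] of at most [(2K + 4)|U|] vertices
   spanning at least [theta x |U| >= eta x |A|] ordered edges, against [small_sets]. *)
have expand (U : {set V}) : (forall u, u \in U -> u \notin Low) -> (#|U| <= D1)%N ->
    ((2 * K + 3) * #|U| <= #|nbrs (adj B) U :\: U|)%N.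
  move=> hU cU; rewrite leqNgt; apply/negP => hlt.
  have U0 : U != set0 by apply: contraTneq hlt => ->; rewrite cards0 muln0.
  pose A := U :|: nbrs (adj B) U.
  have A0 : A != set0.
    have [u uU] := set0Pn _ U0; apply/set0Pn; exists u; by rewrite inE uU.
  have cA : (#|A| <= (2 * K + 4) * #|U|)%N.
    have -> : A = U :|: (nbrs (adj B) U :\: U) by apply/setP => u; rewrite !in_setU in_setD; case: (u \in U).
    apply: leq_trans (leq_card_setU _ _).1 _.
    by rewrite addnS mulSn leq_add2l ltnW.
  have cA' : #|A|%:R <= (2 * K + 4)%:R * #|U|%:R :> R by rewrite -natrM ler_nat.
  have cU' : #|U|%:R <= d1 * n%:R by apply: le_trans D1a; rewrite ler_nat.
  have kd : #|A|%:R <= d * n%:R.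
    apply: le_trans cA' _; apply: le_trans (ler_wpM2l (ler0n _ _) cU') _.
    by rewrite mulrA ler_wpM2r.
  have h1 := small_sets A0 kd.
  have h2 : theta * x * #|U|%:R <= (dcount G (setX A A))%:R.
    apply: (le_trans (_ : _ <= (dcount B (setX U A))%:R)); last first.
      rewrite ler_nat; apply: subset_leq_card; apply/fintype.subsetP => e; rewrite !inE.
      case/andP=> /andP[-> ->] /(adj_sub BG') /(adj_sub G'G) ->.
      by rewrite andbT.
    rewrite dcount_setX natr_sum mulr_natr -sumr_const; apply: ler_sum => u uU.
    apply: le_trans hm1 _; rewrite ler_nat.
    have -> : [set v | adj B u v] :&: A = [set v | adj B u v].
      apply/setIidPl; apply/fintype.subsetP => v; rewrite !inE => uv; apply/orP; right.
      by apply/bigcupP; exists u; rewrite ?inE.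
    by apply: leq_trans (degB u); rewrite pick_nbrsE (negPf (hU _ uU)).
  have h3 : eta * x * #|A|%:R <= theta * x * #|U|%:R.
    apply: (le_trans (_ : _ <= eta * x * ((2 * K + 4)%:R * #|U|%:R))).
      by rewrite ler_wpM2l // mulr_ge0 // ltW.
    rewrite (_ : eta * x * _ = (2 * K + 4)%:R * eta * (x * #|U|%:R)); last by ring.
    by rewrite -[theta * x * _]mulrA ler_wpM2r // mulr_ge0.
  by move: (lt_le_trans h1 (le_trans h3 h2)); rewrite ltxx.
(* The sample keeps a [theta/2] share of the at least [eps/4 * x |X|] edges in [G'], which exceeds
   [t |X|]; some vertex of [X] is above the average. *)
have dense (X Y : {set V}) : (D1 < #|X|)%N -> (n <= 3 * #|Y|)%N ->
    exists2 u, u \in X & (t < #|[set v | adj B u v] :&: Y|)%N.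
  move=> hX hY; have h1 := dense_del (D1lt _ hX) hY.
  have h2 : eps / 4 * d1 * x * n%:R <= (dcount G' (setX X Y))%:R.
    apply: le_trans h1; have := ler_wpM2l (_ : 0 <= eps / 4 * x) (D1lt _ hX).
    by rewrite mulr_ge0 ?divr_ge0 ?(ltW e0) // => /(_ isT); lra.
  have h3 := dJ _ _ h2.
  have h4 : (dcount J (setX X Y))%:R <= (dcount B (setX X Y))%:R :> R by rewrite ler_nat dcount_sub.
  have X0 : 0 < #|X|%:R :> R by rewrite ltr0n; apply: leq_ltn_trans hX.
  have h5 : t%:R * #|X|%:R < (dcount B (setX X Y))%:R :> R.
    apply: (lt_le_trans (_ : _ < theta * eps / 8 * x * #|X|%:R)); first by rewrite ltr_pM2r.
    apply: le_trans h4; apply: le_trans h3.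
    have h6 := ler_wpM2l (ltW th0) h1.
    by clear h2; move: h1 h6; lra_dcount.
  apply: contrapT => nex; move: h5; apply/negP; rewrite -leNgt -natrM ler_nat dcount_setX mulnC.
  rewrite -sum_nat_const; apply: leq_sum => u uX; rewrite leqNgt; apply/negP => h.
  by apply: nex; exists u.
have mindeg2 v : (1 < #|[set u | adj B v u]|)%N.
  by apply: leq_trans (degB v); rewrite pick_nbrsE; case: ifP.
have n2 : (2 < n)%N by rewrite -(ltr_nat R); lra.
apply: (boosted_hamiltonian BG' G'G few_low2 low_uniq expand dense Kt mindeg2 n2).
move=> F BF FG' cF avoid csrc.
have cF' : #|edges F|%:R <= 6 * theta * x * n%:R.
  by apply: le_trans cB; rewrite -natrD ler_nat.
have src3 : n%:R / 3 <= #|boost_src F|%:R :> R.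
  by move: csrc; rewrite -(ler_nat R) natrM; lra.
have src0 : 0 < #|boost_src F|%:R :> R by apply: lt_le_trans src3; lra.
have hb : #|boost_src F|%:R * (n%:R / 3) <= #|boost F|%:R :> R.
  rewrite card_boost natr_sum mulr_natl -sumr_const; apply: ler_sum => u; rewrite inE.
  by rewrite -(ler_nat R) natrM; lra.
have hb9 : 9^-1 * n%:R ^+ 2 <= #|boost F|%:R :> R.
  apply: le_trans hb; have := ler_wpM2r (_ : 0 <= n%:R / 3) src3.
  by rewrite divr_ge0 // => /(_ isT); rewrite expr2; lra.
have h1 := boosters cF' hb9 avoid (fintype.subset_trans FG' G'G).
apply: contrapT => nex.
(* If no booster is in [G'], every booster in [G] is an edge of [H] at a source. This exceeds the
   degree sum of [H] there, since [(1 - eps/10)/3 > 1/3 - eps/2]. *)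
have h2 : (dcount G (boost F) <= dcount H (setX (boost_src F) [set: V]))%N.
  apply: subset_leq_card; apply/fintype.subsetP => e; rewrite [in X in X -> _]inE => /andP[eb eG].
  rewrite !inE; have -> : (n <= 3 * #|ends F e.1|)%N.
    by move: eb; rewrite inE => /andP[]; rewrite inE.
  have [//|nH] := boolP (adj H e.1 e.2); exfalso; apply: nex; exists e => //.
  by rewrite /adj /= inE nH.
have hsrc : d1 * n%:R <= #|boost_src F|%:R.
  by apply: le_trans src3; rewrite mulrC ler_wpM2l // -div1r.
have h3 := degH_sum hsrc.
have h4 : (dcount G (boost F))%:R <= (dcount H (setX (boost_src F) [set: V]))%:R :> R by rewrite ler_nat.
have h5 : (1 - eps / 10) * p * (#|boost_src F|%:R * (n%:R / 3)) <= (1 - eps / 10) * p * #|boost F|%:R.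
  by rewrite ler_wpM2l // mulr_ge0.
have h6 : (1 / 3 - eps / 2) * x * #|boost_src F|%:R < (1 - eps / 10) * p * (#|boost_src F|%:R * (n%:R / 3)).
  rewrite [ltRHS](_ : _ = (1 - eps / 10) / 3 * (x * #|boost_src F|%:R)); last by rewrite /x; field.
  by rewrite -[_ * x * _]mulrA ltr_pM2r // mulr_gt0.
by have := lt_le_trans (lt_trans (lt_le_trans h6 h5) h1) (le_trans h4 h3); rewrite ltxx.
Qed.

End Deterministic.

(** * Choice of constants and the limit *)

Lemma mem_le_sum (R : realType) (l : seq R) (q : R) :
  all (fun r => 0 <= r) l -> q \in l -> q <= \sum_(r <- l) r.
Proof.
elim: l => [//|r l IH] /= /andP[r0 l0]; rewrite big_cons inE => /orP[/eqP ->|/(IH l0) h].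
  by rewrite lerDl big_seq; apply: sumr_ge0 => s /(allP l0).
by apply: le_trans h _; rewrite lerDr.
Qed.

Lemma expRN_le_inv (R : realType) (n : nat) : (0 < n)%N -> expR (- n%:R) <= n%:R^-1 :> R.
Proof.
move=> n0; rewrite expRN lef_pV2 ?posrE ?expR_gt0 ?ltr0n //.
by apply: le_trans (expR_ge1Dx _); rewrite lerDr.
Qed.

(** The constants depend on [e] alone: a larger [eps] admits fewer graphs [H], so the argument can
    be run with [e] in place of [eps]. *)
Lemma resilience_bound (R : realType) (e : R) : 0 < e <= 1 / 10 ->
  exists2 C : R, 0 < C & forall (n : nat) (p eps : R), 0 <= p <= 1 -> e <= eps -> (1 < n)%N ->
    n%:R <= expR (n%:R * p) -> C <= n%:R * p -> C <= n%:R ->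
    gnp_prob p (fun G : sgraph n =>
      ~~ resilient (dtilde (n%:R * p / 100) eps G) (@hamiltonian n) G) <=
    6 / n%:R + C / (n%:R * p).
Proof.
move=> /andP[e0 e1].
pose a : R := e / 10.
have a0 : 0 < a by rewrite divr_gt0.
have a1 : a <= 1 / 100 by rewrite /a; lra.
(* The threshold in [gnp_boosters] for [c = 1/9]. Then [lam = 1/A0] gives [expR (- lam) <= A0], and
   [theta = A0^2/6] gives [lam * (6 theta) = A0]. *)
pose A0 : R := a ^+ 2 * 9^-1 / 32.
have A00 : 0 < A0 by rewrite /A0 !mulr_gt0 ?invr_gt0 ?exprn_gt0.
have A01 : A0 <= 1 / 32.
  have : a ^+ 2 <= 1 by rewrite expr2; nra.
  by rewrite /A0; lra.
pose lam := A0^-1.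
have lam0 : 0 < lam by rewrite invr_gt0.
have hlam : expR (- lam) <= A0.
  rewrite expRN -[leRHS]invrK lef_pV2 ?posrE ?expR_gt0 //.
  by apply: le_trans (expR_ge1Dx _); rewrite lerDr.
pose theta := A0 ^+ 2 / 6.
have th0 : 0 < theta by rewrite divr_gt0 ?exprn_gt0.
have th1 : theta <= 1 / 300 by rewrite /theta expr2; nra.
have hmu : lam * (6 * theta) <= A0.
  rewrite /theta /lam expr2 [6 * _]mulrC divfK // mulrA mulVf ?mul1r //; exact: lt0r_neq0.
(* Later [t] lies between [s x] and [2 s x = theta e/8 * x], and [K >= expR (2/s)] makes [K^t] at
   least [expR (2x) > n]. *)
pose s := theta * e / 16.
have s0 : 0 < s by rewrite divr_gt0 ?mulr_gt0.
pose K := (Num.truncn (expR (2 / s))).+1.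
have hK : expR (2 / s) <= K%:R by apply: ltW; have /andP[] := truncn_itv (expR_ge0 (2 / s)).
pose k4 : R := (2 * K + 4)%:R.
have k40 : 6 <= k4 by rewrite ler_nat -[6%N]/(2 * 1 + 4)%N leq_add2r leq_mul2l.
have k4p : 0 < k4 by lra.
pose eta := theta / k4.
have eta0 : 0 < eta by rewrite divr_gt0.
pose d : R := 2 * expR (- (8 / eta)).
have d0 : 0 < d by rewrite mulr_gt0 ?expR_gt0.
have hd : d * expR (8 / eta) <= 2.
  by rewrite /d -mulrA -expRD addNr expR0 mulr1.
have d2 : d <= 2.
  by rewrite /d ler_piMr // -[leRHS]expR0 ler_expR oppr_le0 divr_ge0 // ltW.
pose d1 := d / k4.
have d10 : 0 < d1 by rewrite divr_gt0.
have d11 : d1 <= 1 / 3.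
  by rewrite /d1 ler_pdivrMr //; lra.
pose d3 := e * d1.
have d30 : 0 < d3 by rewrite mulr_gt0.
pose c0 : R := 4 * expR (15 / 2) * 11 ^+ 5.
have c00 : 0 < c0 by rewrite !mulr_gt0 ?expR_gt0 ?exprn_gt0.
have sE : s = theta * e / 16 by [].
have etaE : eta = theta / k4 by [].
have d1E : d1 = d / k4 by [].
have d3E : d3 = e * d1 by [].
have k4E : k4 = (2 * K + 4)%:R by [].
have A0E : A0 = a ^+ 2 * 9^-1 / 32 by [].
have c0E : c0 = 4 * expR (15 / 2) * 11 ^+ 5 by [].
clearbody c0 d3 d1 d eta k4 K s theta lam A0.
(* All lower bounds required of [x] or [n]; their sum [C] dominates each of them. *)
pose l : seq R := [:: c0; 100 / e; 3 / theta; 3 / (theta * (e / 4 * d1) / 32); 16 / theta; 2 / s;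
  2 / d3; 3 / (a ^+ 2 * d3 ^+ 2 / 16); 2 / (a ^+ 2 * d1 / 16); 1 / (a ^+ 2 * 9^-1 / 16); 1].
have l0 : all (fun r => 0 <= r) l.
  have pos y z : 0 < y -> 0 < z -> 0 <= y / z by move=> y0 z0; rewrite divr_ge0 // ltW.
  have sq0 : 0 < a ^+ 2 by rewrite exprn_gt0.
  rewrite /l /=; do !(apply/andP; split) => //; try apply: pos => //;
    by rewrite ?(ltW c00) // ?divr_gt0 ?mulr_gt0 ?divr_gt0 ?exprn_gt0 ?invr_gt0.
pose C := \sum_(r <- l) r.
have hC q : q \in l -> q <= C by apply: mem_le_sum.
exists C; first by apply: lt_le_trans (hC c0 _) => //; rewrite inE eqxx.
move=> n p eps p01 eeps n1 nx Cx Cn.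
set x := n%:R * p in nx Cx *.
have hx q : q \in l -> q <= x by move=> /hC h; apply: le_trans h Cx.
have hn q : q \in l -> q <= n%:R by move=> /hC h; apply: le_trans h Cn.
have X i : (i < size l)%N -> nth 0 l i <= x by move=> il; apply/hx/mem_nth.
have N i : (i < size l)%N -> nth 0 l i <= n%:R by move=> il; apply/hn/mem_nth.
have sq0 : 0 < a ^+ 2 by rewrite exprn_gt0.
have f1 : 100 <= e * n%:R by have := N 1%N isT; rewrite /= ler_pdivrMr // mulrC.
have f2 : 3 <= theta * x by have := X 2%N isT; rewrite /= ler_pdivrMr // mulrC.
have f3 : 3 <= theta * (e / 4 * d1 * x) / 32.
  have := X 3%N isT; rewrite /= ler_pdivrMr ?divr_gt0 ?mulr_gt0 ?divr_gt0 //.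
  by rewrite (_ : x * _ = theta * (e / 4 * d1 * x) / 32) //; field.
have f4 : 1 <= theta * x / 16.
  by have := X 4%N isT; rewrite /= ler_pdivrMr // => h; rewrite ler_pdivlMr // mul1r mulrC.
have f5 : 2 <= s * x by have := X 5%N isT; rewrite /= ler_pdivrMr // mulrC.
have f6 : 2 <= d3 * n%:R by have := N 6%N isT; rewrite /= ler_pdivrMr // mulrC.
have f7 : 3 <= a ^+ 2 * d3 ^+ 2 / 16 * x.
  by have := X 7%N isT; rewrite /= ler_pdivrMr ?divr_gt0 ?mulr_gt0 ?exprn_gt0 // mulrC.
have f8 : 2 <= a ^+ 2 * d1 / 16 * x.
  by have := X 8%N isT; rewrite /= ler_pdivrMr ?divr_gt0 ?mulr_gt0 ?exprn_gt0 // mulrC.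
have f9 : 1 <= a ^+ 2 * 9^-1 / 16 * x.
  by have := X 9%N isT; rewrite /= ler_pdivrMr ?divr_gt0 ?mulr_gt0 ?invr_gt0 ?exprn_gt0 // mulrC.
have f10 : 1 <= x by have := X 10%N isT.
have x0 : 0 < x by apply: lt_le_trans f10.
have a01 : 0 <= a <= 1 by rewrite (ltW a0) /=; lra.
pose t := (Num.truncn (s * x)).+1.
have sx0 : 0 <= s * x by rewrite mulr_ge0 ?ltW.
have /andP[t1 t2] := truncn_itv sx0.
have ht1 : s * x <= t%:R by apply: ltW.
have ht2 : t%:R < theta * e / 8 * x.
  have -> : theta * e / 8 * x = 2 * (s * x) by rewrite sE; field.
  by rewrite /t -natr1; lra.
have Kt : (n < K ^ t)%N.
  rewrite -(ltr_nat R) natrX; apply: le_lt_trans nx _.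
  apply: (lt_le_trans (_ : _ < expR (2 / s) ^+ t)); last first.
    by apply: lerXn2r => //; rewrite nnegrE ?expR_ge0.
  rewrite -expRM_natl ltr_expR.
  apply: (lt_le_trans (_ : _ < s * x * (2 / s))); last by rewrite ler_wpM2r // divr_ge0 // ltW.
  have -> : s * x * (2 / s) = 2 * x by field; exact: lt0r_neq0.
  lra.
pose bad1 G := [exists AB : {set 'I_n} * {set 'I_n},
    [&& d3 * n%:R <= #|AB.1|%:R, d3 * n%:R <= #|AB.2|%:R &
        (dcount G (offdiag AB.1 AB.2))%:R <= (1 - a) * p * #|offdiag AB.1 AB.2|%:R]].
pose bad2 G := [exists A : {set 'I_n}, (d1 * n%:R <= #|A|%:R) &&
    ((1 + a) * p * #|setX A [set: 'I_n]|%:R <= (dcount G (setX A [set: 'I_n]))%:R)].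
pose bad3 G := [exists A : {set 'I_n}, [&& A != set0, #|A|%:R <= d * n%:R &
     eta * x * #|A|%:R <= (dcount G (setX A A))%:R]].
pose bad4 (G : sgraph n) := [|| clash_edge p G, clash_cherry p G, clash_cycle p G | clash_path p G].
pose bad5 (G : sgraph n) := [exists F : sgraph n,
    [&& #|edges F|%:R <= 6 * theta * x * n%:R, 9^-1 * n%:R ^+ 2 <= #|boost F|%:R :> R,
        [forall d in boost F, (d.1 != d.2) && ~~ adj F d.1 d.2],
        subgraph F G & (dcount G (boost F))%:R <= (1 - a) * p * #|boost F|%:R]].
have b1 : gnp_prob p bad1 <= expR (- n%:R) by apply: gnp_pairs_dense.
have b2 : gnp_prob p bad2 <= expR (- n%:R) by apply: gnp_degree_sum.
have b3 : gnp_prob p bad3 <= 3 / n%:R by apply: gnp_small_sets.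
have b4 : gnp_prob p bad4 <= c0 / x by rewrite c0E; apply: gnp_clash.
have b5 : gnp_prob p bad5 <= expR (- n%:R).
  by rewrite A0E in hlam hmu; apply: (gnp_boosters p01 (@boost n) a01 _ (ltW lam0) hlam hmu).
have good G : ~~ resilient (dtilde (x / 100) eps G) (@hamiltonian n) G ->
    [|| bad1 G, bad2 G, bad3 G, bad4 G | bad5 G].
  apply: contraNT; rewrite 4!negb_or => /and5P[n1' n2' n3' n4' n5'].
  apply/forallP => H; apply/implyP => /andP[HG /forallP Hd].
  apply: (@resilient_hamiltonian R n p e theta eta d d1 d3 K t G H) => //.
  - by rewrite e0 e1.
  - by rewrite th0 th1.
  - by rewrite d3E.
  - by rewrite -k4E d1E mulrC divfK // lt0r_neq0.
  - by rewrite -k4E etaE mulrC divfK // lt0r_neq0.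
  - move=> A B hA hB; rewrite ltNge; apply: contra n1' => h.
    by apply/existsP; exists (A, B); rewrite /= hA hB.
  - move=> A hA; rewrite ltNge; apply: contra n2' => h.
    by apply/existsP; exists A; rewrite hA.
  - move=> A A1 hA; rewrite ltNge; apply: contra n3' => h.
    by apply/existsP; exists A; rewrite A1 hA.
  - move=> F cF cb av FG; rewrite ltNge; apply: contra n5' => h.
    apply/existsP; exists F; rewrite cF cb FG h /= andbT; apply/forallP => q; apply/implyP; exact: av.
  (* As [e <= eps], the bounds for [eps] are at most those for [e]. *)
  - move=> v; apply: le_trans (Hd v) _; rewrite /dtilde -/x; case: ifP => // _.
    by rewrite ler_wpM2l // lerD2l lerN2.
apply: le_trans (gnp_le p01 good) _.
have tot : gnp_prob p (fun G => [|| bad1 G, bad2 G, bad3 G, bad4 G | bad5 G]) <=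
    gnp_prob p bad1 + (gnp_prob p bad2 + (gnp_prob p bad3 + (gnp_prob p bad4 + gnp_prob p bad5))).
  do 3 (apply: le_trans (gnp_or p01 _ _) _; rewrite lerD2l).
  exact: gnp_or.
apply: le_trans tot _.
have i1 := expRN_le_inv R (ltnW n1).
have c0C : c0 / x <= C / x.
  by rewrite ler_wpM2r ?invr_ge0 ?(ltW x0) // hC // inE eqxx.
move: b1 b2 b3 b4 b5 i1 c0C.
move: (gnp_prob p bad1) (gnp_prob p bad2) (gnp_prob p bad3) (gnp_prob p bad4) (gnp_prob p bad5).
move: (expR (- n%:R)) (n%:R^-1) (c0 / x) (C / x) => y z u v p1 p2 p3 p4 p5; clear; lra.
Qed.

Local Open Scope classical_set_scope.
Local Open Scope ring_scope.

Theorem theorem1 (R : realType) (eps : R) (p w : nat -> R)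
  (heps : 0 < eps)
  (hp01 : forall n, 0 <= p n <= 1)
  (hw : w n @[n --> \oo] --> +oo)
  (hp : forall n, (1 < n)%N ->
     (ln n%:R + ln (ln n%:R) + w n) / n%:R <= p n) :
  gnp_prob (p n) (fun G : sgraph n =>
      resilient (dtilde (n%:R * p n / 100) eps G) (@hamiltonian n) G)
    @[n --> \oo] --> (1 : R).
Proof.
(* The constants are chosen for a parameter of at most 1/10. *)
pose e := Num.min eps (1 / 10).
have e01 : 0 < e <= 1 / 10 by rewrite lt_min heps ge_min lexx orbT andbT divr_gt0.
have e_eps : e <= eps by rewrite ge_min lexx.
have [C C0 bound] := resilience_bound e01.
apply/cvgrPdist_le => r r0.
(* The exponential makes [ln n >= C + 2C/r + 1], hence [x >= C], [C/x <= r/2] and, through the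
   summand 1, [ln (ln n) >= 0]. The term [12/r] makes [6/n <= r/2]. *)
have [M hM] : exists M : nat, expR (C + 2 * C / r + 1) + C + 12 / r + 2 <= M%:R.
  by exists (Num.truncn (expR (C + 2 * C / r + 1) + C + 12 / r + 2)).+1; apply/ltW/truncnS_gt.
have Cr : 0 <= 2 * C / r by rewrite divr_ge0 ?mulr_ge0 ?ltW.
have r12 : 0 <= 12 / r by rewrite divr_ge0 ?ltW.
(* With [w n] and [ln (ln n)] nonnegative, the hypothesis on [p] gives [x >= ln n]. *)
have w0 : \forall n \near \oo, 0 <= w n by move/cvgryPge : hw; apply.
near=> n.
have nM : M%:R <= n%:R :> R by rewrite ler_nat; near: n; exact: nbhs_infty_ge.
have wn : 0 <= w n by near: n.
have ex0 := expR_gt0 (C + 2 * C / r + 1).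
have n2 : 2 <= n%:R :> R by move: (expR _) hM ex0 => y; lra.
have n1 : (1 < n)%N by rewrite -(ler_nat R).
have n0 : 0 < n%:R :> R by lra.
have nE : expR (C + 2 * C / r + 1) <= n%:R by move: (expR _) hM ex0 => y; lra.
have nC : C <= n%:R by move: (expR _) hM ex0 => y; lra.
have nr : 12 / r <= n%:R by move: (expR _) hM ex0 => y; lra.
have lnE : C + 2 * C / r + 1 <= ln n%:R.
  by rewrite -[leLHS]expRK ler_ln ?posrE ?expR_gt0.
have lnln : 0 <= ln (ln n%:R : R) by apply: ln_ge0; lra.
have x_ln : ln n%:R <= n%:R * p n.
  have := hp n n1; rewrite ler_pdivrMr // [p n * _]mulrC; lra.
have nx : n%:R <= expR (n%:R * p n) by rewrite -[leLHS]lnK ?posrE // ler_expR.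
have Cx : C <= n%:R * p n by lra.
have x0 : 0 < n%:R * p n by lra.
have h := bound n (p n) eps (hp01 n) e_eps n1 nx Cx nC.
rewrite gnp_compl // opprB addrC subrK ger0_norm; last exact: gnp_prob_ge0.
apply: le_trans h _.
have h1 : 6 / n%:R <= r / 2.
  rewrite ler_pdivrMr //; move: nr; rewrite ler_pdivrMr // => nr; lra.
have h2 : C / (n%:R * p n) <= r / 2.
  rewrite ler_pdivrMr //.
  have : 2 * C / r <= n%:R * p n by lra.
  rewrite ler_pdivrMr // => hr; lra.
lra.
Unshelve. all: by end_near.
Qed.
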